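(* Let $G$ be an infinite connected simple graph with bounded degrees and let $(S_n,P^x)$ be the simple random walk on $G$. Assume that for some $d>1$, $G$ is Ahlfors $d$-regular and satisfies the sub-Gaussian heat kernel upper and lower bounds with walk dimension $d$. Then there exist two non-random constants $c_{\inf}$ and $c_{\sup}$ such that for every $x\in V(G)$, $$\liminf_{n\to\infty}\frac{R_n}{n/\log n}=c_{\inf},\quad P^x\text{-a.s.},\qquad \limsup_{n\to\infty}\frac{R_n}{n/\log n}=c_{\sup},\quad P^x\text{-a.s.}$$ Furthermore, for every $x\in V(G)$, $$r_{\inf}\le c_{\inf}\le\liminf_{n\to\infty}\frac{E^x[R_n]}{n/\log n},$$ and $$r_{\inf}\le c_{\inf}\le c_{\sup}\le r_{\sup}.$$
   Context: The simple random walk $(S_n)_{n\ge 0}$ on $G$ under $P^x$ is the Markov chain with $P^x(S_0=x)=1$ that at each step moves from its current vertex $z$ to each neighbour of $z$ with probability $1/\deg(z)$; $E^x$ is the expectation under $P^x$, and $p_n(x,y)=P^x(S_n=y)$. The range is $R_n=|\{S_0,\dots,S_n\}|$. Set $T_x=\inf\{k\ge 1: S_k=x\}$ and $$r_{\inf}=\liminf_{n\to\infty}(\log n)\inf_{x\in V(G)}P^x(T_x>n),\qquad r_{\sup}=\limsup_{n\to\infty}(\log n)\sup_{x\in V(G)}P^x(T_x>n).$$ $d_G$ is the graph distance on $G$ and $B(x,r)=\{y\in V(G): d_G(x,y)\le r\}$. $G$ is Ahlfors $\alpha$-regular ($\alpha>1$) if there exist positive constants $c_1,c_2$ such that $c_1n^\alpha\le|B(x,n)|\le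 c_2n^\alpha$ for every $n\ge1$ and $x\in V(G)$. $G$ satisfies the sub-Gaussian heat kernel upper bounds with walk dimension $\beta>1$ if there exist positive constants $c_3,c_4$ such that for every $n\ge1$ and $x,y\in V(G)$, $$p_n(x,y)\le\frac{c_3}{|B(x,n^{1/\beta})|}\exp\left(-c_4\frac{d_G(x,y)^{\beta/(\beta-1)}}{n^{1/(\beta-1)}}\right).$$ It satisfies the sub-Gaussian heat kernel lower bounds with walk dimension $\beta$ if there exist positive constants $c_5,c_6$ such that for every $n\ge1$ and $x,y\in V(G)$ with $n\ge d_G(x,y)$, $$p_n(x,y)+p_{n+1}(x,y)\ge\frac{c_5}{|B(x,n^{1/\beta})|}\exp\left(-c_6\frac{d_G(x,y)^{\beta/(\beta-1)}}{n^{1/(\beta-1)}}\right).$$ *)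

(* Defs.v *)
From HB Require Import structures.
From mathcomp Require Import all_boot all_order all_algebra finmap.
From mathcomp Require Import all_classical all_reals all_analysis.

Set Implicit Arguments.
Unset Strict Implicit.
Unset Printing Implicit Defensive.

Import Order.TTheory GRing.Theory Num.Theory.
Import numFieldNormedType.Exports.

Local Open Scope classical_set_scope.
Local Open Scope ring_scope.

Section Graph.
Context {V : choiceType}.
Implicit Types (e : rel V) (x y z : V).

(* [fset_set A] is empty when [A] is infinite; below, [set_size] is only applied to
   neighbourhoods, balls and ranges, which are finite when degrees are bounded *)
Definition set_size (A : set V) : nat := #|` fset_set A|%fset.

Definition neighbours e x : set V := [set y | e x y].

Definition degree e x : nat := set_size (neighbours e x).

Definition bounded_degrees e : Prop :=
  exists D : nat, forall x, (neighbours e x #<= `I_D)%card.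

Definition walk e (n : nat) x y : Prop :=
  exists p : seq V, [/\ path e x p, last x p = y & size p = n].

Definition connected_graph e : Prop := forall x y, exists n, walk e n x y.

(* the length of a shortest walk (0 if there is none) *)
Definition graph_dist e x y : nat :=
  xget 0%N [set n | walk e n x y /\ forall m, walk e m x y -> (n <= m)%N].

Definition graph_ball {R : realType} e x (r : R) : set V :=
  [set y | (graph_dist e x y)%:R <= r].

Definition ahlfors_regular {R : realType} e (alpha : R) : Prop :=
  exists c1 c2 : R, [/\ 0 < c1, 0 < c2 & forall (n : nat) x, (1 <= n)%N ->
    c1 * n%:R `^ alpha <= (set_size (graph_ball e x (n%:R : R)))%:R
      <= c2 * n%:R `^ alpha].

End Graph.

Section RandomWalk.
Context {V : choiceType} {d : measure_display} {Omega : measurableType d}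
  {R : realType}.
Variables (e : rel V) (S : nat -> Omega -> V) (P : V -> probability Omega R).
Implicit Types (x y z : V) (n : nat) (w : Omega).

Definition step_prob z y : R := if e z y then (degree e z)%:R^-1 else 0.

(* [S] is a Markov chain with transition matrix [step_prob], started from [x]
   under [P x]. The Markov property is written without conditioning, so
   it also makes sense for histories [v 0, ..., v n] of probability zero. *)
Record simple_random_walk : Prop := SimpleRandomWalk {
  srw_measurable : forall n (A : set V), measurable (S n @^-1` A) ;
  srw_start : forall x, P x [set w | S 0%N w = x] = 1%E ;
  srw_step : forall x n (v : nat -> V),
    P x [set w | forall k, (k <= n.+1)%N -> S k w = v k] =
    (P x [set w | forall k, (k <= n)%N -> S k w = v k]
      * (step_prob (v n) (v n.+1))%:E)%E }.

Definition heat_kernel n x y : R := fine (P x [set w | S n w = y]).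

Definition sub_gaussian n (b c c' : R) x y : R :=
  c / (set_size (graph_ball e x (n%:R `^ b^-1)))%:R *
  expR (- (c' * ((graph_dist e x y)%:R `^ (b / (b - 1))
                  / n%:R `^ (b - 1)^-1))).

Definition sub_gaussian_upper (b : R) : Prop :=
  exists c3 c4 : R, [/\ 0 < c3, 0 < c4 & forall n x y, (1 <= n)%N ->
    heat_kernel n x y <= sub_gaussian n b c3 c4 x y].

Definition sub_gaussian_lower (b : R) : Prop :=
  exists c5 c6 : R, [/\ 0 < c5, 0 < c6 & forall n x y, (1 <= n)%N ->
    (graph_dist e x y <= n)%N ->
    sub_gaussian n b c5 c6 x y <= heat_kernel n x y + heat_kernel n.+1 x y].

Definition range_size n w : nat := set_size [set S k w | k in `I_n.+1].

Definition return_time x w : \bar R :=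
  ereal_inf [set k%:R%:E | k in [set k : nat | (1 <= k)%N /\ S k w = x]].

Definition no_return_prob n x : \bar R :=
  P x [set w | (n%:R%:E < return_time x w)%E].

Definition r_inf : \bar R :=
  limn_einf (fun n => (ln n%:R)%:E * ereal_inf (range (no_return_prob n)))%E.

Definition r_sup : \bar R :=
  limn_esup (fun n => (ln n%:R)%:E * ereal_sup (range (no_return_prob n)))%E.

Definition scaled_range n w : R := (range_size n w)%:R / (n%:R / ln n%:R).

Definition scaled_mean_range x n : \bar R :=
  ('E_(P x)[fun w => (range_size n w)%:R] * ((n%:R / ln n%:R)^-1)%:E)%E.

End RandomWalk.

(* Main.v *)
Require Import Defs.
From HB Require Import structures.
From mathcomp Require Import all_boot all_order all_algebra finmap.
From mathcomp Require Import all_classical all_reals all_analysis.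
From mathcomp Require Import measurable_realfun.
From mathcomp Require Import ring lra zify.

(** Write p_n for the heat kernel and q_n(x) = P^x(T_x > n).

    On-diagonal bounds.  Volume regularity of exponent d and heat kernel bounds
    of walk dimension d give p_n(x,y) <= C / n and
    p_n(x,x) + p_{n+1}(x,x) >= c / n.  Hence the Green function up to time 2^k
    grows linearly in k.  Decomposing at the last, resp. first, visit to a point
    gives q_{2^k} <= const / k ([noret_log]; in particular the walk is
    recurrent), and shows that, after waiting at least 2^(k-j) steps, the walk
    hits a given point within 2^k further steps with probability at most
    const * (j+1) / k ([gap_hit]).

    Constancy.  Shifting time by one changes the range by at most one, so the
    upper and lower limits of the scaled range are shift invariant.  By the
    Markov property the probability of a shift invariant event is a harmonic
    function of the starting point.  By recurrence it is constant, hence the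
    event is independent of every finite piece of the trajectory, hence of
    itself ([zero_one]).  So both limits are constants ([ae_constant_esup]).

    Comparison with r_inf and r_sup.  Take n between 2^k and 2^(k+1), where
    2^a <= k < 2^(a+1), and cut the trajectory into blocks of length
    m = 2^(k-3a).  The number of visited points is at most the sum of the
    ranges of the blocks, and at least this sum minus the numbers of points
    that each block shares with its future.
    - A point is counted at its last visit, so the mean range of a block, from
      any starting point, lies between m inf q_m and j + m sup q_j for every j
      ([mean_range_ge], [mean_range_le]).  There are about 8^a >= (k/2)^3 blocks
      and each range is at most m, so an exponential moment estimate controls
      the sum of the ranges up to a factor close to 1 ([chernoff_union]).
    - The second moment of the number of points that a block shares with its
      future is O((m a / k^2)^2) ([common_scale]).  Indeed, for each of the two
      points considered, not returning soon costs a factor const / k, and being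
      hit again after a gap costs a factor const * a / k.  Thus the shared points
      number at most eta 2^k / k outside an event of probability O(a^2 / 4^a).
    The exceptional probabilities are O(a^2 / 4^a); summed over the 2^a values of
    k, and then over a, they converge, so the Borel-Cantelli lemma applies
    ([dyadic_ae]).

    Fatou's lemma compares the lower limit with the means ([fatou_range]).

    All estimates are carried out on expectations over finite paths, which are
    finite sums ([pex]).  The law of the first n steps of the given process is
    identified with them in [law]. *)

Import Order.TTheory GRing.Theory Num.Theory.
Import numFieldNormedType.Exports.

Local Open Scope classical_set_scope.
Local Open Scope ring_scope.

Set Implicit Arguments.
Unset Strict Implicit.
Unset Printing Implicit Defensive.

(** * Expectations over finite paths *)

(** A locally finite graph without isolated vertices, given by the duplicate-free
    list of neighbours of each vertex. *)
Record lfgraph (V : eqType) := LFGraph {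
  nbr :> V -> seq V ;
  nbr_uniq : forall x, uniq (nbr x) ;
  nbr_sym : forall x y, (y \in nbr x) = (x \in nbr y) ;
  nbr_gt0 : forall x, (0 < size (nbr x))%N }.

Section PathExpectation.
Variables (R : realFieldType) (V : eqType) (G : lfgraph V).
Implicit Types (x y z : V) (s t : seq V) (f g : seq V -> R).

(** One step of the walk: the mean of [f] over the neighbours of [x]. *)
Definition avg x (f : V -> R) : R := (\sum_(y <- G x) f y) / (size (G x))%:R.

(** [pex n x f] is the expectation of [f [:: S_1; ...; S_n]] for the simple random
    walk started from [x].  The starting point is not part of the list, so that
    concatenating paths is concatenating lists; the endpoint is [last x s]. *)
Fixpoint pex n x f : R :=
  if n is n'.+1 then avg x (fun y => pex n' y (fun s => f (y :: s))) else f [::].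

Lemma le_avg x (f g : V -> R) : {in G x, forall y, f y <= g y} -> avg x f <= avg x g.
Proof.
move=> fg; rewrite ler_wpM2r ?invr_ge0// big_seq [leRHS]big_seq.
exact: ler_sum.
Qed.

Lemma eq_avg x (f g : V -> R) : {in G x, f =1 g} -> avg x f = avg x g.
Proof. by move=> fg; apply/le_anti; rewrite !le_avg// => y /fg ->. Qed.

Lemma avgD x (f g : V -> R) : avg x (fun y => f y + g y) = avg x f + avg x g.
Proof. by rewrite /avg big_split mulrDl. Qed.

Lemma avgZ x c (f : V -> R) : avg x (fun y => c * f y) = c * avg x f.
Proof. by rewrite /avg -mulr_sumr mulrA. Qed.

Lemma avg_cst x c : avg x (fun=> c) = c.
Proof.
rewrite /avg big_const_seq count_predT iter_addr_0 -[c *+ _]mulr_natr mulfK//.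
by rewrite pnatr_eq0 -lt0n nbr_gt0.
Qed.

Lemma avg_ge0 x (f : V -> R) : {in G x, forall y, 0 <= f y} -> 0 <= avg x f.
Proof. by move=> f0; rewrite -(avg_cst x 0) le_avg. Qed.

Lemma avgZr x c (f : V -> R) : avg x (fun y => f y * c) = avg x f * c.
Proof. by rewrite mulrC -avgZ; apply: eq_avg => y _; rewrite mulrC. Qed.

Lemma avg_sum x (I : Type) (r : seq I) (F : I -> V -> R) :
  avg x (fun y => \sum_(i <- r) F i y) = \sum_(i <- r) avg x (F i).
Proof. by rewrite /avg exchange_big mulr_suml. Qed.

Lemma le_pex n x f g : (forall s, size s = n -> f s <= g s) -> pex n x f <= pex n x g.
Proof.
elim: n x f g => [|n IH] x f g fg /=; first exact: fg.
by apply: le_avg => y _; apply: IH => s sn; apply: fg; rewrite /= sn.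
Qed.

Lemma eq_pex n x f g : (forall s, size s = n -> f s = g s) -> pex n x f = pex n x g.
Proof. by move=> fg; apply/le_anti; rewrite !le_pex// => s /fg ->. Qed.

Lemma pexD n x f g : pex n x (fun s => f s + g s) = pex n x f + pex n x g.
Proof.
elim: n x f g => [//|n IH] x f g /=; rewrite -avgD.
by apply: eq_avg => y _; rewrite IH.
Qed.

Lemma pexZ n x c f : pex n x (fun s => c * f s) = c * pex n x f.
Proof.
elim: n x f => [//|n IH] x f /=; rewrite -avgZ.
by apply: eq_avg => y _; rewrite IH.
Qed.

Lemma pex_cst n x c : pex n x (fun=> c) = c.
Proof.
elim: n x => [//|n IH] x /=; rewrite -[RHS](avg_cst x).
by apply: eq_avg => y _; rewrite IH.
Qed.

Lemma pex_sum n x (I : Type) (r : seq I) (F : I -> seq V -> R) :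
  pex n x (fun s => \sum_(i <- r) F i s) = \sum_(i <- r) pex n x (F i).
Proof.
elim: r => [|i r IH].
  by rewrite big_nil -[RHS](pex_cst n x); apply: eq_pex => s _; rewrite big_nil.
rewrite big_cons -IH -pexD; apply: eq_pex => s _; by rewrite big_cons.
Qed.

Lemma pex_ge0 n x f : (forall s, size s = n -> 0 <= f s) -> 0 <= pex n x f.
Proof. by move=> f0; rewrite -[leLHS](pex_cst n x) le_pex. Qed.

Lemma pex_le_cst n x c f : (forall s, size s = n -> f s <= c) -> pex n x f <= c.
Proof. by move=> f0; rewrite -[leRHS](pex_cst n x) le_pex. Qed.

(** The Markov property at time [m]. *)
Lemma pex_cat m n x f :
  pex (m + n) x f = pex m x (fun s => pex n (last x s) (fun t => f (s ++ t))).
Proof.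
elim: m x f => [//|m IH] x f; rewrite addSn /=.
by apply: eq_avg => y _; rewrite IH.
Qed.

Lemma pex_prefix m n x f : (m <= n)%N ->
  pex n x (fun s => f (take m s)) = pex m x f.
Proof.
move=> mn; rewrite -(subnKC mn) pex_cat; apply: eq_pex => s sm.
rewrite -[RHS](pex_cst (n - m) (last x s)); apply: eq_pex => t _.
by rewrite take_size_cat.
Qed.

(** Transition probabilities, the probability of visiting [y] at some time in
    [0, n], the probability q_n of not returning during [1, n], and the Green
    function, i.e. the expected number of visits to [y] during [0, n]. *)
Definition hk n x y : R := pex n x (fun s => (last x s == y)%:R).
Definition hit n x y : R := pex n x (fun s => (y \in x :: s)%:R).
Definition noret n x : R := pex n x (fun s => (x \notin s)%:R).
Definition green n x y : R := \sum_(0 <= k < n.+1) hk k x y.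

Lemma pex_last n x (phi : V -> R) :
  pex n.+1 x (fun s => phi (last x s)) = pex n x (fun s => avg (last x s) phi).
Proof. by rewrite -addn1 pex_cat; apply: eq_pex => s _ /=; apply: eq_avg=> y _; rewrite last_cat. Qed.

Lemma hkS n x y : hk n.+1 x y = avg x (fun z => hk n z y).
Proof. by []. Qed.

Lemma hk_ge0 n x y : 0 <= hk n x y.
Proof. by apply: pex_ge0 => s _; rewrite ler0n. Qed.

Lemma hkD m n x y : hk (m + n) x y = pex m x (fun s => hk n (last x s) y).
Proof.
by rewrite /hk pex_cat; apply: eq_pex => s _; apply: eq_pex => t _; rewrite last_cat.
Qed.

Lemma hit_ge0 n x y : 0 <= hit n x y.
Proof. by apply: pex_ge0 => s _; rewrite ler0n. Qed.

Lemma hit_le1 n x y : hit n x y <= 1.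
Proof. by apply: pex_le_cst => s _; rewrite lern1 leq_b1. Qed.

Lemma hitxx n x : hit n x x = 1.
Proof. by rewrite -[RHS](pex_cst n x); apply: eq_pex => s _; rewrite mem_head. Qed.

Lemma hitS n x y : x != y -> hit n.+1 x y = avg x (fun z => hit n z y).
Proof.
move=> xy; rewrite /hit /=; apply: eq_avg => z _; apply: eq_pex => s _.
by rewrite in_cons eq_sym (negPf xy).
Qed.

Lemma hit0 x y : hit 0 x y = (x == y)%:R.
Proof. by rewrite /hit /= inE eq_sym. Qed.

Lemma le_hit m n x y : (m <= n)%N -> hit m x y <= hit n x y.
Proof.
move=> mn; rewrite /hit -(@pex_prefix m n)//; apply: le_pex => s _.
rewrite ler_nat !inE; case: eqP => //= _.
by case: (boolP (y \in take m s)) => // /mem_take ->.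
Qed.

Lemma noret_ge0 n x : 0 <= noret n x.
Proof. by apply: pex_ge0 => s _; rewrite ler0n. Qed.

Lemma le_noret m n x : (m <= n)%N -> noret n x <= noret m x.
Proof.
move=> mn; rewrite /noret -(@pex_prefix m n)//; apply: le_pex => s _.
rewrite ler_nat; case: (boolP (x \in s)) => //= xs.
by case: (boolP (x \in take m s)) => // /mem_take; rewrite (negPf xs).
Qed.

Lemma noretS n x : noret n.+1 x = 1 - avg x (fun z => hit n z x).
Proof.
apply/eqP; rewrite eq_sym subr_eq; apply/eqP.
rewrite /noret /= -avgD -[LHS](avg_cst x); apply: eq_avg => y _.
rewrite /hit -pexD -[LHS](pex_cst n y); apply: eq_pex => s _.
by case: (x \in _); rewrite /= ?addr0 ?add0r.
Qed.

Lemma green_ge0 n x y : 0 <= green n x y.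
Proof. by apply: sumr_ge0 => k _; exact: hk_ge0. Qed.

Lemma greenS n x y : green n.+1 x y = (x == y)%:R + avg x (fun z => green n z y).
Proof.
rewrite /green big_nat_recl//; congr (_ + _).
by rewrite avg_sum; apply: eq_bigr => k _; rewrite hkS.
Qed.

Lemma le_green m n x y : (m <= n)%N -> green m x y <= green n x y.
Proof.
move=> mn; rewrite /green [leRHS](@big_cat_nat _ _ _ m.+1)//=.
by rewrite lerDl sumr_ge0// => k _; exact: hk_ge0.
Qed.

(** Decomposition according to the time of the last visit to [x] before [n]. *)
Lemma last_exit n z x :
  \sum_(0 <= k < n.+1) hk k z x * noret (n - k) x = hit n z x.
Proof.
elim: n z => [|n IH] z.
  by rewrite big_nat1 hit0 /hk /noret /= mulr1.
rewrite big_nat_recl//= subn0.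
under eq_bigr => k _ do rewrite hkS subSS mulrC -avgZ.
rewrite -avg_sum.
rewrite (eq_avg (g := fun z => hit n z x)); last first.
  by move=> y _; rewrite -IH; apply: eq_bigr => k _; rewrite mulrC.
case: (altP (z =P x)) => [->|zx].
  by rewrite /hk /= eqxx mul1r noretS hitxx subrK.
by rewrite /hk /= (negPf zx) mul0r add0r hitS.
Qed.

Lemma noret_green n x : noret n x * green n x x <= 1.
Proof.
rewrite -(hitxx n x) -last_exit /green mulr_sumr; apply: ler_sum => k _.
by rewrite mulrC ler_wpM2l ?hk_ge0// le_noret// leq_subr.
Qed.

(** Once [x] is hit, within [n] steps, it is visited [green N x x] times on average
    during the next [N] steps. *)
Lemma hit_green n N z x : hit n z x * green N x x <= green (n + N) z x.
Proof.
elim: n z => [|n IH] z.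
  rewrite hit0; case: eqP => [->|_]; first by rewrite mul1r.
  by rewrite mul0r green_ge0.
case: (altP (z =P x)) => [->|zx].
  by rewrite hitxx mul1r le_green// leq_addl.
rewrite hitS// addSn greenS (negPf zx) add0r mulrC -avgZ.
by apply: le_avg => y _; rewrite mulrC.
Qed.

(** To visit both points one visits one of them first, then the other. *)
Lemma double_hit n w x y :
  pex n w (fun s => ((x \in w :: s) && (y \in w :: s))%:R) <=
  hit n w x * hit n x y + hit n w y * hit n y x.
Proof.
elim: n w => [|n IH] w.
  rewrite /= !hit0 !inE (eq_sym x w) (eq_sym y w).
  case: eqP => [<-|_]; case: eqP => [E|_]; rewrite ?E ?eqxx /= ?mul0r ?mul1r ?addr0 ?add0r ?lexx ?ler0n//.
  by rewrite lerDl.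
case: (altP (w =P x)) => [->|wx].
  rewrite hitxx mul1r; apply: (le_trans (y := hit n.+1 x y)).
    by apply: le_pex => s _; rewrite mem_head.
  by rewrite lerDl mulr_ge0 ?hit_ge0.
case: (altP (w =P y)) => [->|wy].
  rewrite (hitxx _ y) mul1r; apply: (le_trans (y := hit n.+1 y x)).
    by apply: le_pex => s _; rewrite mem_head andbT.
  by rewrite lerDr mulr_ge0 ?hit_ge0.
apply: (le_trans (y := avg w (fun z => hit n z x * hit n x y + hit n z y * hit n y x))).
  apply: le_avg => z _; apply: le_trans (IH z).
  by apply: le_pex => s _; rewrite [x \in w :: _]in_cons [y \in w :: _]in_cons ![_ == w]eq_sym (negPf wx) (negPf wy).
rewrite avgD (hitS n wx) (hitS n wy).
rewrite !avgZr; apply: lerD; rewrite ler_wpM2l ?le_hit//;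
  by apply: avg_ge0 => z _; exact: hit_ge0.
Qed.

(** The mean number of distinct points among S_1, ..., S_n. *)
Definition mean_range n x : R := pex n x (fun s => (size (undup s))%:R).

(** [undup] keeps the last occurrence of each point, so S_1 contributes when it is
    not visited again. *)
Lemma mean_rangeS n x :
  mean_range n.+1 x = avg x (fun y => noret n y + mean_range n y).
Proof.
apply: eq_avg => y _; rewrite -pexD; apply: eq_pex => s _ /=.
by case: ifP => _ /=; rewrite ?add0r// -natr1 addrC.
Qed.

Lemma mean_range_ge n x b : (forall y, b <= noret n y) -> n%:R * b <= mean_range n x.
Proof.
suff H k : (k <= n)%N -> forall x, (forall y, b <= noret n y) -> k%:R * b <= mean_range k x.
  exact: H.
elim: k => [|k IH] kn {}x hb; first by rewrite mul0r /mean_range /=.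
rewrite mean_rangeS -[leLHS](avg_cst x); apply: le_avg => y _.
rewrite -natr1 mulrDl mul1r addrC lerD ?IH//; last exact: ltnW.
by rewrite (le_trans (hb y))// le_noret// ltnW.
Qed.

(** All times but the last [j] leave at least [j] steps for a return. *)
Lemma mean_range_le j n x b : 0 <= b -> (forall y, noret j y <= b) ->
  mean_range n x <= j%:R + n%:R * b.
Proof.
move=> b0 hb; elim: n x => [|n IH] x.
  by rewrite mul0r addr0 /mean_range /= ler0n.
case: (leqP j n) => jn; last first.
  apply: (le_trans (y := j%:R)); last by rewrite lerDl mulr_ge0.
  apply: pex_le_cst => s sn; rewrite ler_nat.
  by rewrite (leq_trans (size_undup s))// sn.
rewrite mean_rangeS -[leRHS](avg_cst x); apply: le_avg => y _.
rewrite -natr1 mulrDl mul1r [leLHS]addrC addrA lerD ?IH//.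
by apply: le_trans (hb y); rewrite le_noret.
Qed.

End PathExpectation.

(** * Sums and reversibility *)
Section Harmonic.
Variable R : realFieldType.

Lemma harmonic_dyadic_ge (K : nat) : K%:R / 2 <= \sum_(1 <= j < 2 ^ K) j%:R^-1 :> R.
Proof.
elim: K => [|K IH]; first by rewrite mul0r big_geq.
have pK : (0 < 2 ^ K)%N by rewrite expn_gt0.
rewrite (@big_cat_nat _ _ _ (2 ^ K))//=; last by rewrite expnS; lia.
rewrite -natr1 mulrDl lerD//.
apply: (le_trans (y := \sum_(2 ^ K <= j < 2 ^ K.+1) (2 ^ K.+1)%:R^-1)).
  rewrite sumr_const_nat -[leRHS]mulr_natr expnS.
  have -> : (2 * 2 ^ K - 2 ^ K = 2 ^ K)%N by lia.
  by rewrite natrM invfM mulfVK ?mul1r// pnatr_eq0 -lt0n.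
apply: ler_sum_nat => j /andP[j1 j2].
by rewrite lef_pV2 ?posrE ?ltr0n ?ler_nat ?expn_gt0//; [exact: ltnW|exact: leq_trans j1].
Qed.

Lemma harmonic_dyadic_le (u b : nat) :
  \sum_(2 ^ u <= j < 2 ^ (u + b)) j%:R^-1 <= b%:R :> R.
Proof.
elim: b => [|b IH]; first by rewrite addn0 big_geq.
rewrite (@big_cat_nat _ _ _ (2 ^ (u + b)))//=; last 2 first.
- by rewrite leq_exp2l// leq_addr.
- by rewrite leq_exp2l// addnS.
rewrite -natr1 lerD//.
have p : (0 < 2 ^ (u + b))%N by rewrite expn_gt0.
apply: (le_trans (y := \sum_(2 ^ (u + b) <= j < 2 ^ (u + b.+1)) (2 ^ (u + b))%:R^-1)).
  apply: ler_sum_nat => j /andP[j1 j2].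
  by rewrite lef_pV2 ?posrE ?ltr0n ?ler_nat//; exact: leq_trans j1.
rewrite sumr_const_nat -[leLHS]mulr_natr addnS expnS.
have -> : (2 * 2 ^ (u + b) - 2 ^ (u + b) = 2 ^ (u + b))%N by lia.
by rewrite mulVf// pnatr_eq0 -lt0n.
Qed.

Lemma sum_window_le (n lo hi : nat) :
  (\sum_(0 <= j < n) (lo <= j < hi) <= hi - lo)%N.
Proof.
suff : (\sum_(0 <= j < n) (lo <= j < hi) <= minn n hi - lo)%N by lia.
by elim: n => [|n IH]; [rewrite big_geq|rewrite big_nat_recr//=; lia].
Qed.

End Harmonic.

Lemma sum_pred1 (R : pzRingType) (V : eqType) (s : seq V) (F : V -> R) (y : V) :
  uniq s -> \sum_(z <- s) (z == y)%:R * F z = (y \in s)%:R * F y.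
Proof.
elim: s => [|z s IH] /=; first by rewrite big_nil mul0r.
move=> /andP[zs us]; rewrite big_cons IH// inE eq_sym.
by case: eqP => [->|_]; rewrite ?(negPf zs) ?mul0r ?addr0 ?add0r.
Qed.

Section Reversible.
Variables (R : realFieldType) (V : eqType) (G : lfgraph V).
Local Notation deg x := ((size (G x))%:R : R).
Local Notation hk := (hk R G).
Local Notation green := (green R G).

Lemma deg_gt0 x : 0 < deg x. Proof. by rewrite ltr0n nbr_gt0. Qed.

(** Decomposition at the last step, by symmetry of the adjacency relation. *)
Lemma hkS_last n x y : hk n.+1 x y = \sum_(z <- G y) hk n x z / deg z.
Proof.
rewrite /hk (pex_last G n x (fun z => (z == y)%:R)).
under [RHS]eq_bigr => z _ do rewrite mulrC -pexZ.
rewrite -pex_sum; apply: eq_pex => // s _; set w := last x s.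
rewrite /avg.
under eq_bigr => z _ do rewrite -[_%:R]mulr1.
rewrite (sum_pred1 _ _ (nbr_uniq _ _)) mulr1.
under [RHS]eq_bigr => z _ do rewrite mulrC eq_sym.
by rewrite (sum_pred1 (fun z => (deg z)^-1) _ (nbr_uniq _ _)) nbr_sym.
Qed.

Lemma hk_sym n x y : deg x * hk n x y = deg y * hk n y x.
Proof.
elim: n x y => [|n IH] x y.
  by rewrite /hk /= eq_sym; case: eqP => [->|]; rewrite ?mulr0.
rewrite [hk n.+1 y x]hkS_last /hk /= /avg [LHS]mulrC mulfVK ?gt_eqF ?deg_gt0// mulr_sumr.
apply: eq_bigr => z _; rewrite mulrA -[pex _ _ _ _]/(hk n z y) -IH mulrAC divff ?mul1r// gt_eqF ?deg_gt0//.
Qed.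

Variable D : nat.
Hypothesis deg_le : forall x, (size (G x) <= D)%N.

Lemma le_hk_sym n x y : hk n x y <= D%:R * hk n y x.
Proof.
apply: (le_trans (y := deg x * hk n x y)).
  by rewrite ler_peMl ?hk_ge0// ler1n nbr_gt0.
by rewrite hk_sym ler_wpM2r ?hk_ge0// ler_nat.
Qed.

Lemma le_green_sym n x y : green n x y <= D%:R * green n y x.
Proof. by rewrite /green mulr_sumr; apply: ler_sum => k _; exact: le_hk_sym. Qed.

End Reversible.

(** * Consequences of the on-diagonal bounds *)

(** The degrees are at most [D], p_n(x,y) <= C / n and
    c / n <= p_n(x,x) + p_{n+1}(x,x). *)
Section CriticalHeatKernel.
Variables (R : realFieldType) (V : eqType) (G : lfgraph V).
Local Notation hk := (hk R G).
Local Notation hit := (hit R G).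
Local Notation noret := (noret R G).
Local Notation green := (green R G).
Variables (D : nat) (C c : R).
Hypothesis deg_le : forall x, (size (G x) <= D)%N.
Hypothesis C_ge0 : 0 <= C.
Hypothesis c_ge0 : 0 <= c.
Hypothesis hk_upper : forall n x y, (0 < n)%N -> hk n x y <= C / n%:R.
Hypothesis hk_lower : forall n x, (0 < n)%N -> c / n%:R <= hk n x x + hk n.+1 x x.

Lemma green_diag_ge K x : c / 4 * K%:R <= green (2 ^ K) x x.
Proof.
have p : (0 < 2 ^ K)%N by rewrite expn_gt0.
(* each of the two families p_j and p_(j+1) is bounded by the Green function *)
have H1 : \sum_(1 <= j < 2 ^ K) hk j x x <= green (2 ^ K) x x.
  rewrite /green big_nat_recr//= (big_ltn p).
  by have := hk_ge0 R G 0 x x; have := hk_ge0 R G (2 ^ K) x x; lra.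
have H2 : \sum_(1 <= j < 2 ^ K) hk j.+1 x x <= green (2 ^ K) x x.
  rewrite /green big_nat_recl//= (@big_cat_nat _ _ _ 1 0)//= big_nat1.
  by have := hk_ge0 R G 0 x x; have := hk_ge0 R G 1 x x; lra.
have H3 : c * (K%:R / 2) <= \sum_(1 <= j < 2 ^ K) (hk j x x + hk j.+1 x x).
  apply: le_trans (ler_wpM2l c_ge0 (harmonic_dyadic_ge R K)) _.
  by rewrite mulr_sumr; apply: ler_sum_nat => j /andP[j1 _]; exact: hk_lower.
by move: H3; rewrite big_split /=; lra.
Qed.

Lemma noret_log K x : noret (2 ^ K) x * (c / 4 * K%:R) <= 1.
Proof.
apply: le_trans (noret_green R G (2 ^ K) x).
by rewrite ler_wpM2l ?noret_ge0// green_diag_ge.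
Qed.

Lemma hit_log M K z x : (M <= 2 ^ K)%N ->
  hit M z x * (c / 4 * K%:R) <= green (2 ^ K.+1) z x.
Proof.
move=> MK; rewrite expnS mul2n -addnn.
apply: le_trans (hit_green R G (2 ^ K) (2 ^ K) z x).
apply: ler_pM; rewrite ?hit_ge0 ?le_hit ?green_diag_ge//.
by rewrite mulr_ge0 ?divr_ge0.
Qed.

Lemma gap_green u b r N z x : (2 ^ u <= r)%N -> (2 ^ u + N.+1 <= 2 ^ (u + b))%N ->
  pex G r z (fun s => green N (last z s) x) <= C * b%:R.
Proof.
move=> ur uN; rewrite /green pex_sum.
apply: le_trans (ler_wpM2l C_ge0 (harmonic_dyadic_le R u b)).
rewrite [leRHS](_ : _ = \sum_(0 <= k < 2 ^ (u + b) - 2 ^ u) C * (k + 2 ^ u)%:R^-1); last first.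
  by rewrite mulr_sumr -{1}[(2 ^ u)%N]add0n big_addn.
have Nub : (N.+1 <= 2 ^ (u + b) - 2 ^ u)%N by rewrite leq_subRL// (leq_trans _ uN)// leq_addr.
rewrite [leRHS](@big_cat_nat _ _ _ N.+1)//=.
apply: ler_wpDr; first by apply: sumr_ge0 => k _; rewrite mulr_ge0 ?invr_ge0.
have p : (0 < 2 ^ u)%N by rewrite expn_gt0.
apply: ler_sum_nat => k _; rewrite -hkD.
have rk : (0 < r + k)%N by lia.
apply: le_trans (hk_upper z x rk) _.
by rewrite ler_wpM2l// lef_pV2 ?posrE ?ltr0n ?ler_nat//; lia.
Qed.

(** After at least 2^u steps, a given point is hit within 2^K further steps with
    probability O(b / K), where u + b is slightly larger than K. *)
Lemma gap_hit M K u b r z x : (M <= 2 ^ K)%N -> (2 ^ u <= r)%N ->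
  (2 ^ u + (2 ^ K.+1).+1 <= 2 ^ (u + b))%N ->
  pex G r z (fun s => hit M (last z s) x) * (c / 4 * K%:R) <= C * b%:R.
Proof.
move=> MK ur ub; apply: le_trans (gap_green z x ur ub).
by rewrite mulrC -pexZ; apply: le_pex => s _; rewrite mulrC hit_log.
Qed.

(** The same with the roles of the two points exchanged, by reversibility. *)
Lemma gap_hit_sym M K u b r z x : (M <= 2 ^ K)%N -> (2 ^ u <= r)%N ->
  (2 ^ u + (2 ^ K.+1).+1 <= 2 ^ (u + b))%N ->
  pex G r z (fun s => hit M x (last z s)) * (c / 4 * K%:R) <= D%:R * (C * b%:R).
Proof.
move=> MK ur ub; apply: (le_trans (y := D%:R * pex G r z (fun s => green (2 ^ K.+1) (last z s) x))).
  rewrite mulrC -!pexZ; apply: le_pex => s _; rewrite mulrC.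
  by apply: le_trans (hit_log _ _ MK) _; exact: le_green_sym.
by rewrite ler_wpM2l// (gap_green _ _ ur ub).
Qed.

End CriticalHeatKernel.

(** * Points shared by a block and its future *)
Section Intersections.
Variables (R : realFieldType) (V : eqType) (G : lfgraph V).
Local Notation hit := (hit R G).
Local Notation noret := (noret R G).
Implicit Types (s t : seq V) (x y z : V).

(** The number of distinct points of [s] that occur in [t]. *)
Definition common s t : nat := size [seq y <- undup s | y \in t].

Lemma common_cons y s t : common (y :: s) t = ((y \notin s) && (y \in t) + common s t)%N.
Proof.
rewrite /common /=; case: (y \in s) => //=.
by case: (y \in t).
Qed.

(** A common point is counted at its last occurrence in [s]; the element of index
    [i] of [s] is written [last x (take i.+1 s)]. *)
Lemma common_sum x s t : common s t =
  (\sum_(0 <= i < size s) ((last x (take i.+1 s) \notin drop i.+1 s)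
                           && (last x (take i.+1 s) \in t)))%N.
Proof.
elim: s x => [|y s IH] x; first by rewrite big_geq.
by rewrite common_cons /= big_nat_recl//= take0 drop0 /= (IH y).
Qed.

Lemma le_common s t t' : {subset t <= t'} -> (common s t <= common s t')%N.
Proof. by move=> tt'; rewrite /common !size_filter; apply: sub_count. Qed.

Lemma size_undup_cat s t :
  (size (undup (s ++ t)) + common s t = size (undup s) + size (undup t))%N.
Proof.
rewrite undup_cat size_cat addnAC; congr (_ + _)%N.
by rewrite /common !size_filter addnC -(count_predC (mem t) (undup s)).
Qed.

(** The element of index [i] of [s] does not occur among the next [g] elements and
    occurs in [t]. *)
Definition late_hit x (g i : nat) s t : bool :=
  (last x (take i.+1 s) \notin take g (drop i.+1 s)) && (last x (take i.+1 s) \in t).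

Lemma common_le x g s t : (2 * g <= size s)%N ->
  (common s t <= 2 * g + \sum_(0 <= i < size s - 2 * g) late_hit x g i s t)%N.
Proof.
move=> gs; rewrite (common_sum x) (@big_cat_nat _ _ _ (size s - 2 * g))//=; last by lia.
rewrite addnC leq_add//.
  apply: (@leq_trans (\sum_(size s - 2 * g <= i < size s) 1)).
    by apply: leq_sum => i _; case: (_ && _).
  by rewrite sum_nat_const_nat; lia.
apply: leq_sum => i _; rewrite /late_hit.
set y := last _ _; case: (boolP (y \in drop _ _)) => //= yd.
case: (boolP (y \in take _ _)) => // /mem_take; by rewrite (negPf yd).
Qed.

(** [m] is the length of the block, [M] that of its future and [g] that of a gap;
    [A] bounds the probability of hitting a point after a gap and [B] that of not
    returning during a gap. *)
Variables (g m M : nat) (A B : R).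
Hypothesis g_le : (2 * g <= m)%N.
Hypothesis A_ge0 : 0 <= A.
Hypothesis B_ge0 : 0 <= B.
Hypothesis gap_to : forall r z x, (g <= r)%N ->
  pex G r z (fun s => hit M (last z s) x) <= A.
Hypothesis gap_from : forall r z x, (g <= r)%N ->
  pex G r z (fun s => hit M x (last z s)) <= A.
Hypothesis noret_gap : forall x, noret g x <= B.

Lemma pex_scale_le n x (a b : R) (f : seq V -> R) : 0 <= a -> pex G n x f <= b ->
  pex G n x (fun s => a * f s) <= a * b.
Proof. by move=> a0 fb; rewrite pexZ ler_wpM2l. Qed.

(** The path is cut at the times of the two points, after a gap of length [g]
    following each, and at the end of the block.  Each point is not revisited
    during the gap that follows it, which gives [B ^+ 2].  The future hits both
    points: a gap before the end of the block gives one factor [A]; going from one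
    point to the other is again a hit after a gap, which gives the other one. *)
Lemma late_hit_pair x i j : (i + 2 * g <= j)%N -> (j < m - 2 * g)%N ->
  pex G (m + M) x (fun s => (late_hit x g i (take m s) (drop m s))%:R *
                            (late_hit x g j (take m s) (drop m s))%:R)
  <= 2 * (A * B) ^+ 2.
Proof.
move=> ij jm; pose r := (j - i - g)%N; pose e := (m - j.+1 - g)%N.
have -> : (m + M = i.+1 + (g + (r + (g + (e + M)))))%N by rewrite /r /e; lia.
rewrite pex_cat; apply: pex_le_cst => a sa; rewrite pex_cat; set y := last x a.
rewrite [leRHS](_ : _ = 2 * A * A * B * B); last by ring.
apply: (le_trans (y := pex G g y (fun b => 2 * A * A * B * (y \notin b)%:R))); last first.
  by apply: pex_scale_le; [rewrite !mulr_ge0|exact: noret_gap].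
apply: le_pex => b sb; rewrite pex_cat; set u := last y b.
apply: (le_trans (y := pex G r u (fun c => A * B * (y \notin b)%:R *
         (hit M y (last u c) + hit M (last u c) y)))); last first.
  rewrite [leRHS](_ : _ = A * B * (y \notin b)%:R * (A + A)); last by ring.
  apply: pex_scale_le; first by rewrite !mulr_ge0.
  by rewrite pexD lerD ?gap_to ?gap_from//; rewrite /r; lia.
apply: le_pex => c sc; rewrite pex_cat; set z := last u c.
apply: (le_trans (y := pex G g z (fun d => A * (y \notin b)%:R *
         (hit M y z + hit M z y) * (z \notin d)%:R))); last first.
  rewrite [leRHS](_ : _ = A * (y \notin b)%:R * (hit M y z + hit M z y) * B); last by ring.
  by apply: pex_scale_le; [rewrite !mulr_ge0 ?addr_ge0 ?hit_ge0|exact: noret_gap].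
apply: le_pex => d sd; rewrite pex_cat; set v := last z d.
apply: (le_trans (y := pex G e v (fun e' => (y \notin b)%:R * (z \notin d)%:R *
         (hit M (last v e') y * hit M y z + hit M (last v e') z * hit M z y)))); last first.
  rewrite [leRHS](_ : _ = (y \notin b)%:R * (z \notin d)%:R *
             (hit M y z * A + hit M z y * A)); last by ring.
  apply: pex_scale_le; first by rewrite !mulr_ge0.
  under eq_pex do rewrite [hit _ _ y * _]mulrC [hit _ _ z * _]mulrC.
  by rewrite pexD lerD ?pex_scale_le ?hit_ge0 ?gap_to//; rewrite /e; lia.
apply: le_pex => e' se; set w := last v e'.
apply: le_trans (ler_wpM2l _ (double_hit R G M w y z)); last by rewrite !mulr_ge0.
rewrite -pexZ; apply: le_pex => t _.
have st : size (a ++ b ++ c ++ d ++ e') = m.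
  by rewrite !size_cat sa sb sc sd se /r /e; lia.
have -> : a ++ b ++ c ++ d ++ e' ++ t = (a ++ b ++ c ++ d ++ e') ++ t by rewrite !catA.
rewrite take_size_cat// drop_size_cat// /late_hit.
rewrite take_size_cat// drop_size_cat// take_size_cat// -/y.
have -> : a ++ b ++ c ++ d ++ e' = (a ++ b ++ c) ++ d ++ e' by rewrite !catA.
have sabc : size (a ++ b ++ c) = j.+1 by rewrite !size_cat sa sb sc /r; lia.
rewrite take_size_cat// drop_size_cat// take_size_cat// !last_cat -/y -/u -/z.
rewrite -!natrM -!mulnb ler_nat !inE.
by case: (y \in b); case: (y \in t); case: (z \in d); case: (z \in t);
   rewrite ?orbT ?muln0 ?mul0n//; case: (_ == _).
Qed.

(** The diagonal pairs, those at distance less than [2 * g], are bounded by their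
    number. *)
Lemma late_hit_sq_le x :
  pex G (m + M) x (fun s => (\sum_(0 <= i < m - 2 * g)
     (late_hit x g i (take m s) (drop m s))%:R) ^+ 2)
  <= 4 * g%:R * m%:R + 2 * (m%:R * (A * B)) ^+ 2 :> R.
Proof.
set m' := (m - 2 * g)%N.
pose Z i j := pex G (m + M) x (fun s => (late_hit x g i (take m s) (drop m s))%:R *
                            (late_hit x g j (take m s) (drop m s))%:R) : R.
have ZC i j : Z i j = Z j i by apply: eq_pex => s _; rewrite mulrC.
have Z1 i j : Z i j <= 1.
  by apply: pex_le_cst => s _; rewrite -natrM mulnb lern1 leq_b1.
have -> : pex G (m + M) x (fun s => (\sum_(0 <= i < m')
     (late_hit x g i (take m s) (drop m s))%:R) ^+ 2)
   = \sum_(0 <= i < m') \sum_(0 <= j < m') Z i j.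
  under [RHS]eq_bigr => i _ do rewrite -pex_sum.
  rewrite -pex_sum; apply: eq_pex => s _; rewrite expr2 mulr_suml.
  by apply: eq_bigr => i _; rewrite mulr_sumr.
have AB : 0 <= 2 * (A * B) ^+ 2 by rewrite mulr_ge0 ?exprn_ge0 ?mulr_ge0.
have Zle i j : (i < m')%N -> (j < m')%N ->
    Z i j <= (i.+1 - 2 * g <= j < i + 2 * g)%N%:R + 2 * (A * B) ^+ 2.
  move=> im jm; case: (leqP (i + 2 * g) j) => [ij|ij].
    by rewrite andbF add0r late_hit_pair.
  case: (leqP (j + 2 * g) i) => [ji|ji].
    by rewrite ZC; apply: (le_trans (late_hit_pair _ ji im)); rewrite lerDr.
  have -> : (i.+1 - 2 * g <= j)%N by lia.
  by apply: (le_trans (Z1 i j)); rewrite lerDl.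
have m'm : (m' <= m)%N by rewrite /m'; lia.
apply: (le_trans (y := \sum_(0 <= i < m') (4 * g%:R + m%:R * (2 * (A * B) ^+ 2)))); last first.
  rewrite sumr_const_nat subn0 -[leLHS]mulr_natl.
  apply: (le_trans (y := m%:R * (4 * g%:R + m%:R * (2 * (A * B) ^+ 2)))).
    by rewrite ler_wpM2r ?ler_nat// addr_ge0 ?mulr_ge0.
  by rewrite le_eqVlt; apply/orP; left; apply/eqP; ring.
apply: ler_sum_nat => i /andP[_ im].
apply: (le_trans (y := \sum_(0 <= j < m') ((i.+1 - 2 * g <= j < i + 2 * g)%N%:R + 2 * (A * B) ^+ 2))).
  by apply: ler_sum_nat => j /andP[_ jm]; exact: Zle.
rewrite big_split /= lerD//.
  rewrite -natr_sum -natrM ler_nat; apply: leq_trans (sum_window_le _ _ _) _; lia.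
by rewrite sumr_const_nat subn0 -[leLHS]mulr_natl ler_wpM2r ?ler_nat.
Qed.

Lemma common_sq_le x :
  pex G (m + M) x (fun s => (common (take m s) (drop m s))%:R ^+ 2)
  <= 12 * g%:R * m%:R + 4 * (m%:R * (A * B)) ^+ 2 :> R.
Proof.
have gm : 2 * g%:R <= m%:R :> R by rewrite -natrM ler_nat.
pose W s : R := \sum_(0 <= i < m - 2 * g) (late_hit x g i (take m s) (drop m s))%:R.
apply: (le_trans (y := pex G (m + M) x (fun s => 8 * g%:R ^+ 2 + 2 * W s ^+ 2))).
  apply: le_pex => s ss; set K := (common _ _)%:R.
  have sm : size (take m s) = m by rewrite size_takel// ss leq_addr.
  have : K <= 2 * g%:R + W s.
    rewrite /K /W -natr_sum -natrM -natrD ler_nat -{3}sm.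
    by apply: common_le; rewrite sm.
  move=> KW; have K0 : 0 <= K by [].
  have : K ^+ 2 <= (2 * g%:R + W s) ^+ 2 by rewrite lerXn2r// nnegrE (le_trans K0).
  by have := sqr_ge0 (2 * g%:R - W s); nra.
rewrite pexD pex_cst pexZ; have := late_hit_sq_le x; rewrite -/(W _).
have : g%:R ^+ 2 * 2 <= g%:R * m%:R :> R.
  by rewrite expr2 -mulrA ler_wpM2l// mulrC.
by move: (pex _ _ _ _) (_ ^+ 2) (_ ^+ 2) => *; lra.
Qed.

End Intersections.

(** * Cutting a path into blocks *)
Section Blocks.
Variables (R : realType) (V : eqType) (G : lfgraph V).
Implicit Types (s t : seq V) (x y z : V).
Variable m : nat.

(** The sum of the ranges of the first [l] blocks of length [m] of [s]. *)
Fixpoint block_ranges l s : nat :=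
  if l is l'.+1 then (size (undup (take m s)) + block_ranges l' (drop m s))%N else 0%N.

(** The sum over the first [l] blocks of the number of points that the block shares
    with the rest of [s]. *)
Fixpoint block_commons l s : nat :=
  if l is l'.+1 then (common (take m s) (drop m s) + block_commons l' (drop m s))%N else 0%N.

Lemma size_undup_cat_le s t :
  (size (undup (s ++ t)) <= size (undup s) + size (undup t))%N.
Proof. by rewrite -size_undup_cat leq_addr. Qed.

Lemma le_size_undup s t : {subset s <= t} -> (size (undup s) <= size (undup t))%N.
Proof.
move=> st; apply: uniq_leq_size; first exact: undup_uniq.
by move=> y; rewrite !mem_undup; exact: st.
Qed.

Lemma range_le_blocks n l s : (n <= l * m)%N ->
  (size (undup (take n s)) <= block_ranges l s)%N.
Proof.
elim: l n s => [|l IH] n s /= nl; first by move: nl; rewrite mul0n leqn0 => /eqP ->; rewrite take0.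
apply: (@leq_trans (size (undup (take m s ++ take (n - m) (drop m s))))).
  apply: le_size_undup => y; rewrite mem_cat.
  case: (leqP m n) => mn.
    by rewrite -{1}(subnKC mn) takeD mem_cat.
  by rewrite -(subnKC (ltnW mn)) takeD mem_cat => ->.
apply: leq_trans (size_undup_cat_le _ _) _; rewrite leq_add2l IH//.
by move: nl; rewrite mulSn; lia.
Qed.

Lemma blocks_le_range l L s : (l <= L)%N -> size s = (L * m)%N ->
  (block_ranges l s <= size (undup (take (l * m) s)) + block_commons L s)%N.
Proof.
elim: l L s => [//|l IH] [//|L] s lL; rewrite mulSn => sL /=.
have sm : size (take m s) = m by rewrite size_takel// sL leq_addr.
rewrite mulSn takeD.
have {IH} := IH L (drop m s) lL; rewrite size_drop sL addKn => /(_ erefl) IH.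
have := size_undup_cat (take m s) (take (l * m) (drop m s)).
have : (common (take m s) (take (l * m) (drop m s)) <= common (take m s) (drop m s))%N.
  by apply: le_common => y /mem_take.
by move: IH; lia.
Qed.

(** Minkowski's inequality in the L2 norm, for [l] terms of norm at most
    [Num.sqrt E]. *)
Lemma block_commons_sq (E : R) l M x : (l * m <= M)%N ->
  (forall M' y, (M' <= M)%N ->
     pex G (m + M') y (fun s => (common (take m s) (drop m s))%:R ^+ 2) <= E) ->
  pex G (l * m) x (fun s => (block_commons l s)%:R ^+ 2) <= l%:R ^+ 2 * E.
Proof.
move=> lM hE; elim: l lM x => [|l IH] lM x; first by rewrite /= expr0n/= mul0r.
have lM' : (l * m <= M)%N by move: lM; rewrite mulSn; lia.
have E0 : 0 <= E.
  by apply: le_trans (hE 0%N x (leq0n _)); apply: pex_ge0 => s _; rewrite sqr_ge0.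
rewrite mulSn; apply: (le_trans (y := pex G (m + l * m) x (fun s =>
   (1 + l%:R) * (common (take m s) (drop m s))%:R ^+ 2 +
   (1 + l%:R^-1) * (block_commons l (drop m s))%:R ^+ 2))).
  apply: le_pex => s _ /=; rewrite natrD; move: (common _ _)%:R => a.
  case: (posnP l) => [->|l0]; first by rewrite /= expr0n/= !addr0 mul1r mulr0 addr0.
  move: (block_commons _ _)%:R => b.
  have l0' : 0 < l%:R :> R by rewrite ltr0n.
  rewrite -subr_ge0 [leRHS](_ : _ = (l%:R * a - b) ^+ 2 / l%:R); last by field; rewrite gt_eqF.
  by rewrite divr_ge0 ?sqr_ge0.
rewrite pexD !pexZ.
apply: (le_trans (y := (1 + l%:R) * E + (1 + l%:R^-1) * (l%:R ^+ 2 * E))).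
  rewrite lerD ?ler_wpM2l ?addr_ge0 ?invr_ge0 ?hE//.
  rewrite pex_cat; apply: pex_le_cst => s sm; apply: le_trans (IH lM' (last x s)).
  by apply: le_pex => t _; rewrite drop_size_cat.
rewrite -[l.+1%:R]natr1; case: (posnP l) => [->|l0]; first by rewrite expr0n/=; lra.
have l0' : l%:R != 0 :> R by rewrite pnatr_eq0 -lt0n.
by rewrite le_eqVlt; apply/orP; left; apply/eqP; field.
Qed.

Lemma block_commons_tail (E b : R) l M x : 0 < b -> (l * m <= M)%N ->
  (forall M' y, (M' <= M)%N ->
     pex G (m + M') y (fun s => (common (take m s) (drop m s))%:R ^+ 2) <= E) ->
  pex G (l * m) x (fun s => (b <= (block_commons l s)%:R)%R%:R) <= l%:R ^+ 2 * E / b ^+ 2.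
Proof.
move=> b0 lM hE; rewrite mulrC.
apply: le_trans (ler_wpM2l _ (block_commons_sq x lM hE)); last by rewrite invr_ge0 sqr_ge0.
rewrite -pexZ; apply: le_pex => s _; case: (boolP (b <= _)) => H /=.
  by rewrite mulrC ler_pdivlMr ?exprn_gt0// mul1r lerXn2r// nnegrE ?(ltW b0).
by apply: mulr_ge0; rewrite ?invr_ge0 ?sqr_ge0.
Qed.

Lemma expR_quad (z : R) : z <= 2^-1 -> expR z <= 1 + z + 2 * z ^+ 2.
Proof.
move=> z2; have z1 : 0 < 1 - z by lra.
have H : 1 - z <= expR (- z) by have := expR_ge1Dx (- z); lra.
rewrite -[leLHS]opprK -[z in expR z]opprK expRN opprK.
apply: (le_trans (y := (1 - z)^-1)).
  by rewrite lef_pV2 ?posrE ?expR_gt0.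
rewrite -[leLHS]mul1r ler_pdivrMr//.
have : 0 <= z ^+ 2 * (1 - 2 * z) by rewrite mulr_ge0 ?sqr_ge0//; lra.
by rewrite expr2; lra.
Qed.

Hypothesis m_gt0 : (0 < m)%N.

(** The sign of [th] decides whether [q] bounds the normalised mean range from
    above ([0 < th]) or from below ([th < 0]), so that both tails are treated
    at once. *)
Lemma block_exp (th q : R) x : `|th| <= 2^-1 ->
  (forall y, th * mean_range R G m y <= th * (q * m%:R)) ->
  pex G m x (fun s => expR (th * ((size (undup s))%:R / m%:R)))
  <= expR (th * (1 + 2 * th) * q).
Proof.
rewrite ler_norml => /andP[th1 th2] hth.
apply: le_trans (expR_ge1Dx _).
apply: (le_trans (y := pex G m x (fun s => 1 + (th * (1 + 2 * th)) / m%:R * (size (undup s))%:R))).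
  apply: le_pex => s sm; set y := _ / _.
  have y0 : 0 <= y by rewrite divr_ge0.
  have y1 : y <= 1.
    by rewrite /y ler_pdivrMr ?ltr0n// mul1r ler_nat -[leqRHS]sm size_undup.
  rewrite [leRHS](_ : _ = 1 + th * (1 + 2 * th) * y); last by rewrite /y mulrAC mulrA.
  apply: le_trans (expR_quad _) _; first by nra.
  have : y ^+ 2 <= y by rewrite expr2; nra.
  by move=> ?; have := sqr_ge0 th; nra.
rewrite pexD pex_cst lerD2l pexZ -/(mean_range R G m x).
have := hth x; rewrite [leRHS]mulrA -ler_pdivrMr ?ltr0n// => H.
have p : 0 <= 1 + 2 * th by lra.
rewrite [leLHS](_ : _ = (1 + 2 * th) * (th * mean_range R G m x / m%:R)); last by ring.
by rewrite [leRHS](_ : _ = (1 + 2 * th) * (th * q)) ?ler_wpM2l//; ring.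
Qed.

Lemma blocks_exp (th q : R) l x : `|th| <= 2^-1 ->
  (forall y, th * mean_range R G m y <= th * (q * m%:R)) ->
  pex G (l * m) x (fun s => expR (th * ((block_ranges l s)%:R / m%:R)))
  <= expR (l%:R * (th * (1 + 2 * th) * q)).
Proof.
move=> th1 hth; elim: l x => [|l IH] x; first by rewrite mul0n /= mul0r mulr0 mul0r.
rewrite mulSn pex_cat.
apply: (le_trans (y := pex G m x (fun s => expR (l%:R * (th * (1 + 2 * th) * q)) *
   expR (th * ((size (undup s))%:R / m%:R))))); last first.
  rewrite pexZ -[l.+1%:R]natr1 [X in _ <= expR X]mulrDl mul1r expRD ler_wpM2l ?expR_ge0//; exact: block_exp.
apply: le_pex => s sm; rewrite mulrC.
apply: le_trans (ler_wpM2l (expR_ge0 _) (IH (last x s))).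
rewrite -pexZ; apply: le_pex => t _ /=.
by rewrite take_size_cat// drop_size_cat// -expRD natrD mulrDl mulrDr.
Qed.

(** For [0 < th] the event says that the range sum is at least [1 + 4 * th] times
    its upper estimate; for [th < 0], that it is at most [1 + 4 * th] times its
    lower estimate. *)
Lemma blocks_tail (th q : R) l x : `|th| <= 2^-1 ->
  (forall y, th * mean_range R G m y <= th * (q * m%:R)) ->
  pex G (l * m) x (fun s => (th * ((1 + 4 * th) * q * l%:R) <=
                             th * ((block_ranges l s)%:R / m%:R))%R%:R)
  <= expR (- (2 * th ^+ 2 * q * l%:R)).
Proof.
move=> th1 hth; set u := th * (_ * l%:R).
apply: (le_trans (y := pex G (l * m) x (fun s =>
   expR (- u) * expR (th * ((block_ranges l s)%:R / m%:R))))).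
  apply: le_pex => s _; rewrite -expRD; case: (boolP (u <= _)) => H /=; rewrite ?expR_ge0//.
  by rewrite -[leLHS]expR0 ler_expR addrC subr_ge0.
rewrite pexZ; apply: le_trans (ler_wpM2l (expR_ge0 _) (blocks_exp l x th1 hth)) _.
by rewrite -expRD ler_expR le_eqVlt; apply/orP; left; apply/eqP; rewrite /u; ring.
Qed.

End Blocks.

Lemma pex_has (R : realFieldType) (V : eqType) (G : lfgraph V) n x (I : Type)
    (r : seq I) (P : I -> seq V -> bool) :
  pex G n x (fun s => (has (P^~ s) r)%:R) <=
  \sum_(i <- r) pex G n x (fun s => (P i s)%:R) :> R.
Proof.
rewrite -pex_sum; apply: le_pex => s _; elim: r => [|i r IH] /=; first by rewrite big_nil.
rewrite big_cons; case: (P i s) => /=; last by rewrite add0r.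
by rewrite lerDl sumr_ge0.
Qed.

Lemma block_ranges_take (V : eqType) m l n (s : seq V) : (l * m <= n)%N ->
  block_ranges m l (take n s) = block_ranges m l s.
Proof.
elim: l n s => [//|l IH] n s; rewrite mulSn => ln /=.
have mn : (m <= n)%N by lia.
rewrite -{1 2}(subnKC mn) takeD.
case: (leqP m (size s)) => ms.
  have sm : size (take m s) = m by rewrite size_takel.
  by rewrite take_size_cat// drop_size_cat// IH//; lia.
rewrite take_oversize ?size_cat; last first.
  by rewrite size_take_min size_take_min size_drop; lia.
have d0 : drop m s = [::] by rewrite drop_oversize// ltnW.
by rewrite d0 cats0 take_oversize ?drop_oversize//; lia.
Qed.

Lemma sqr_le_exp2 a : (a ^ 2 <= 2 ^ a.+1)%N.
Proof.
case: (ltnP a 3); first by case: a => [|[|[|a]]].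
elim: a => [//|a IH]; rewrite leq_eqVlt => /orP[/eqP <-//|a3].
by have := IH a3; rewrite [(2 ^ a.+2)%N]expnS; nia.
Qed.

(** * Deviations at scale 2^k *)
Section Scales.
Variable R : realType.
Implicit Types (a k : nat).

Lemma expRN_cube (y : R) : 0 < y -> expR (- y) <= 27 / y ^+ 3.
Proof.
move=> y0; have H : y / 3 <= expR (y / 3) by have := expR_ge1Dx (y / 3); lra.
have : (y / 3) ^+ 3 <= expR (y / 3) ^+ 3 by rewrite lerXn2r// nnegrE ?expR_ge0 ?divr_ge0 ?ltW.
rewrite -expRM_natl [3%:R * _]mulrC divfK// => {}H.
rewrite expRN -[leRHS]invrK lef_pV2 ?posrE ?expR_gt0 ?invr_gt0 ?divr_gt0 ?exprn_gt0//.
by rewrite invf_div -[27](_ : 3 ^+ 3 = _) -?expr_div_n//; lra.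
Qed.

(* the scale: 2 ^ a <= k < 2 ^ a.+1 *)
(** At scale [k], with 2^a <= k < 2^(a+1), a path of 2^(k+1) steps consists of
    [2 * 2 ^ (3 * a)] blocks of length 2^(k-3a).  The
    sums over the first [l] of them, for all [l] from half of their number on, are
    controlled simultaneously. *)
Lemma chernoff_union (V : eqType) (G : lfgraph V) a k x (th q q0 : R) :
  (2 ^ a <= k < 2 ^ a.+1)%N -> (3 * a <= k)%N ->
  `|th| <= 2^-1 -> th != 0 -> 0 < q0 -> q0 / k%:R <= q ->
  (forall y, th * mean_range R G (2 ^ (k - 3 * a)) y <= th * (q * (2 ^ (k - 3 * a))%:R)) ->
  pex G (2 ^ k.+1) x (fun s => (has (fun l : nat =>
      th * ((1 + 4 * th) * q * l%:R) <=
      th * ((block_ranges (2 ^ (k - 3 * a)) l s)%:R / (2 ^ (k - 3 * a))%:R))%R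
      (index_iota (2 ^ (3 * a)) (2 * 2 ^ (3 * a)).+1))%:R)
  <= 54 / (th ^+ 2 * q0) ^+ 3 * (4 ^- a).
Proof.
move=> /andP[k1 k2] ak th1 th0 q00 q0q hth; set m := (2 ^ (k - 3 * a))%N; set L := (2 ^ (3 * a))%N.
have m0 : (0 < m)%N by rewrite expn_gt0.
have Lm : (2 * L * m = 2 ^ k.+1)%N by rewrite -mulnA -expnD expnS; congr (_ * 2 ^ _)%N; lia.
have k0 : (0 < k)%N by rewrite (leq_trans _ k1)// expn_gt0.
have kR : 0 < k%:R :> R by rewrite ltr0n.
pose P (l : nat) (s : seq V) : bool := th * ((1 + 4 * th) * q * l%:R) <=
      th * ((block_ranges m l s)%:R / m%:R).
apply: le_trans (@pex_has R V G (2 ^ k.+1) x nat _ P) _.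
have pos : 0 < th ^+ 2 * q0 by rewrite mulr_gt0// exprn_even_gt0.
have aR : 0 < 4 ^+ a :> R by rewrite exprn_gt0.
apply: (le_trans (y := \sum_(L <= l < (2 * L).+1) 27 / (th ^+ 2 * q0 * 4 ^+ a) ^+ 3)).
  apply: ler_sum_nat => l /andP[l1 l2].
  have lm : (l * m <= 2 ^ k.+1)%N by rewrite -Lm leq_mul2r; apply/orP; right; lia.
  have -> : pex G (2 ^ k.+1) x (fun s => (P l s)%:R) = pex G (l * m) x (fun s => (P l s)%:R) :> R.
    rewrite -(pex_prefix G x _ lm); apply: eq_pex => s _.
    by rewrite /P block_ranges_take.
  apply: le_trans (blocks_tail m0 l x th1 hth) _.
  apply: le_trans (expRN_cube _); last by rewrite mulr_gt0.
  rewrite ler_expR lerN2.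
  have h4 : 4 ^+ a * k%:R <= 2 * l%:R :> R.
    rewrite -natrX -!natrM ler_nat (@leq_trans (2 * L))//; last by lia.
    rewrite (@leq_trans (4 ^ a * 2 ^ a.+1))//; first by rewrite leq_mul2l ltnW ?orbT.
    by rewrite -[4%N]/(2 ^ 2)%N -expnM -expnD -expnS leq_exp2l//; lia.
  have h5 : q0 <= q * k%:R by rewrite -ler_pdivrMr.
  have t0 := sqr_ge0 th.
  have h6 : 4 ^+ a * q0 <= 2 * q * l%:R.
    apply: (le_trans (y := 4 ^+ a * k%:R * q)); first by rewrite -mulrA ler_wpM2l ?(ltW aR)// mulrC.
    rewrite [leRHS](_ : _ = 2 * l%:R * q); last by ring.
    rewrite ler_wpM2r//; apply: le_trans q0q; by rewrite divr_ge0 ?ltW.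
  rewrite [leLHS](_ : _ = th ^+ 2 * (4 ^+ a * q0)); last by ring.
  by rewrite [leRHS](_ : _ = th ^+ 2 * (2 * q * l%:R)) ?ler_wpM2l//; ring.
rewrite sumr_const_nat -[leLHS]mulr_natr.
have h8 : ((2 * L).+1 - L)%N%:R <= 2 * 4 ^+ a * 4 ^+ a :> R.
  rewrite -natrX -!natrM ler_nat.
  have : (1 <= L)%N by rewrite expn_gt0.
  have : (L <= 4 ^ a * 4 ^ a)%N.
    by rewrite -[4%N]/(2 ^ 2)%N -expnM -expnD leq_exp2l//; lia.
  by lia.
apply: le_trans (ler_wpM2l _ h8) _; first by rewrite ltW// divr_gt0// exprn_gt0// mulr_gt0.
rewrite le_eqVlt; apply/orP; left; apply/eqP; field.
by rewrite gt_eqF// gt_eqF//= gt_eqF.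
Qed.

End Scales.

(** Shared points at the same scale, under the on-diagonal bounds. *)
Section CommonTail.
Variables (R : realType) (V : eqType) (G : lfgraph V).
Variables (D : nat) (C c : R).
Hypothesis deg_le : forall x, (size (G x) <= D)%N.
Hypothesis C_ge0 : 0 <= C.
Hypothesis c_gt0 : 0 < c.
Hypothesis hk_upper : forall n x y, (0 < n)%N -> hk R G n x y <= C / n%:R.
Hypothesis hk_lower : forall n x, (0 < n)%N -> c / n%:R <= hk R G n x x + hk R G n.+1 x x.

(** [common_sq_le] is applied with the gap 2^(k-7a), which is 2^(-4a) times the
    length of the block; so the pairs of points at distance less than twice the
    gap contribute at most O(m^2 / k^4). *)
Lemma common_scale : exists2 E : R, 0 <= E & forall a k M x,
  (2 ^ a <= k < 2 ^ a.+1)%N -> (14 * a <= k)%N -> (M <= 2 ^ k.+1)%N ->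
  pex G (2 ^ (k - 3 * a) + M) x (fun s =>
     (common (take (2 ^ (k - 3 * a)) s) (drop (2 ^ (k - 3 * a)) s))%:R ^+ 2)
  <= E * ((2 ^ (k - 3 * a))%:R * a.+1%:R / k%:R ^+ 2) ^+ 2.
Proof.
(* [gap_hit] with b = 7a + 3 <= 7 (a + 1) and the constant c / 4 gives
   A = A0 (a + 1) / k *)
pose A0 := 28 * (D.+1)%:R * C / c.
have A00 : 0 <= A0 by rewrite divr_ge0 ?mulr_ge0// ltW.
exists (192 + 256 * A0 ^+ 2 / c ^+ 2).
  by rewrite addr_ge0// divr_ge0 ?sqr_ge0// mulr_ge0 ?sqr_ge0.
move=> a k M x /andP[k1 k2] ak Mk.
have k0 : (0 < k)%N by rewrite (leq_trans _ k1)// expn_gt0.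
have kR : 0 < k%:R :> R by rewrite ltr0n.
set m := (2 ^ (k - 3 * a))%N; pose g := (2 ^ (k - 7 * a))%N.
have [a0|a0] := posnP a.
  (* then k = 1 and the block has two steps; [common] is at most 2 *)
  have k1' : k = 1%N by move: k1 k2; rewrite a0; lia.
  subst a k; apply: (le_trans (y := 4)).
    apply: pex_le_cst => s _; rewrite -natrX ler_nat -[4%N]/(2 ^ 2)%N leq_exp2r//.
    rewrite /common size_filter (leq_trans (count_size _ _))// (leq_trans (size_undup _))//.
    by rewrite size_take_min geq_minl.
  have -> : m%:R = 2 :> R by [].
  have := divr_ge0 (mulr_ge0 (ler0n R 256) (sqr_ge0 A0)) (sqr_ge0 c).
  move: (256 * A0 ^+ 2 / c ^+ 2) => Z Z0.
  by rewrite (expr1n R 2 : 1%:R ^+ 2 = 1) divr1 mulr1 expr2; lra.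
pose A := A0 * a.+1%:R / k%:R; pose B := 8 / (c * k%:R).
have gA : (2 * g <= m)%N by rewrite -expnS leq_exp2l//; lia.
have A_ge0 : 0 <= A by rewrite divr_ge0// mulr_ge0.
have B_ge0 : 0 <= B by rewrite divr_ge0// ltW// mulr_gt0.
have ub : (2 ^ (k - 7 * a) + (2 ^ k.+2).+1 <= 2 ^ (k - 7 * a + (7 * a + 3)))%N.
  rewrite addnA subnK; last by lia.
  have : (2 ^ (k - 7 * a) <= 2 ^ k)%N by rewrite leq_exp2l// leq_subr.
  have : (2 <= 2 ^ k)%N by rewrite -[X in (X <= _)%N]expn1 leq_exp2l.
  by rewrite addn3 !expnS; lia.
have ck : 0 < c / 4 * k.+1%:R by rewrite mulr_gt0 ?divr_gt0.
have DA : D%:R * (C * (7 * a + 3)%:R) <= A * (c / 4 * k.+1%:R).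
  rewrite /A /A0 [leRHS](_ : _ = 7 * D.+1%:R * C * a.+1%:R * (k.+1%:R / k%:R)); last first.
    by field; rewrite !gt_eqF.
  have k11 : 1 <= k.+1%:R / k%:R :> R by rewrite ler_pdivlMr// mul1r ler_nat.
  apply: (le_trans (y := 7 * D.+1%:R * C * a.+1%:R)); last first.
    by rewrite ler_peMr// !mulr_ge0.
  rewrite mulrCA [leRHS](_ : _ = C * (7 * D.+1%:R * a.+1%:R)); last by ring.
  rewrite ler_wpM2l// -!natrM ler_nat; nia.
have gap_to r z y : (g <= r)%N -> pex G r z (fun s => hit R G M (last z s) y) <= A.
  move=> gr; rewrite -(ler_pM2r ck).
  apply: le_trans (gap_hit C_ge0 (ltW c_gt0) hk_upper hk_lower z y Mk gr ub) _.
  case: (posnP D) => [D0|D0].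
    by have := deg_le z; rewrite D0 leqn0 => /eqP Gz; have := nbr_gt0 G z; rewrite Gz.
  apply: le_trans DA; rewrite ler_peMl ?mulr_ge0// ler1n; lia.
have gap_from r z y : (g <= r)%N -> pex G r z (fun s => hit R G M y (last z s)) <= A.
  move=> gr; rewrite -(ler_pM2r ck).
  by apply: le_trans DA; exact: (gap_hit_sym deg_le C_ge0 (ltW c_gt0) hk_upper hk_lower z y Mk gr ub).
have noret_gap y : noret R G g y <= B.
  have := noret_log (ltW c_gt0) hk_lower (k - 7 * a) y; rewrite -/g => H.
  have kk : k%:R <= 2 * (k - 7 * a)%:R :> R by rewrite -natrM ler_nat; lia.
  rewrite /B ler_pdivlMr ?mulr_gt0//.
  have := noret_ge0 R G g y; move: (noret _ _ _ _) H => q H q0.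
  have : q * (c * k%:R) <= q * (c * (2 * (k - 7 * a)%:R)).
    by rewrite ler_wpM2l// ler_wpM2l// ltW.
  by nra.
apply: le_trans (common_sq_le gA A_ge0 B_ge0 gap_to gap_from noret_gap x) _.
have gm : g%:R * k%:R ^+ 4 <= 16 * m%:R :> R.
  rewrite -natrX -!natrM ler_nat.
  have -> : (16 = 2 ^ 4)%N by [].
  have k4 : (k ^ 4 <= 2 ^ (a.+1 * 4))%N by rewrite expnM leq_exp2r// ltnW.
  apply: (leq_trans (leq_mul (leqnn g) k4)).
  by rewrite -!expnD leq_exp2l//; lia.
rewrite [leRHS](_ : _ = 192 * m%:R * a.+1%:R ^+ 2 * (m%:R / k%:R ^+ 4) +
                 4 * (m%:R * (A * B)) ^+ 2); last first.
  by rewrite /A /B; field; rewrite !gt_eqF.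
rewrite lerD2r; apply: (le_trans (y := 192 * m%:R * (m%:R / k%:R ^+ 4))).
  rewrite [leLHS](_ : _ = 12 * m%:R * g%:R); last by ring.
  rewrite [leRHS](_ : _ = 12 * m%:R * (16 * m%:R / k%:R ^+ 4)); last by ring.
  by rewrite ler_wpM2l// ler_pdivlMr// exprn_gt0.
rewrite ler_wpM2r ?divr_ge0 ?exprn_ge0// ler_peMr//.
by rewrite -natrX ler1n expn_gt0.
Qed.

Lemma common_tail (eta : R) : 0 < eta -> exists2 E : R, 0 <= E & forall a k x,
  (2 ^ a <= k < 2 ^ a.+1)%N -> (14 * a <= k)%N ->
  pex G (2 ^ k.+1) x (fun s =>
     (eta * (2 ^ k)%:R / k%:R <=
      (block_commons (2 ^ (k - 3 * a)) (2 * 2 ^ (3 * a)) s)%:R)%R%:R)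
  <= E * (a.+1%:R ^+ 2 / 4 ^+ a).
Proof.
move=> eta0; have [E E0 hE] := common_scale.
exists (4 * E / eta ^+ 2); first by rewrite divr_ge0 ?sqr_ge0// mulr_ge0 ?sqr_ge0.
move=> a k x kk ak; have /andP[k1 k2] := kk.
have k0 : (0 < k)%N by rewrite (leq_trans _ k1)// expn_gt0.
have kR : 0 < k%:R :> R by rewrite ltr0n.
have Lm : (2 * 2 ^ (3 * a) * 2 ^ (k - 3 * a) = 2 ^ k.+1)%N.
  by rewrite -mulnA -expnD expnS; congr (_ * 2 ^ _)%N; lia.
have p2 j : 0 < (2 ^ j)%:R :> R by rewrite ltr0n expn_gt0.
have b0 : 0 < eta * (2 ^ k)%:R / k%:R by rewrite divr_gt0 ?mulr_gt0.
have lM : (2 * 2 ^ (3 * a) * 2 ^ (k - 3 * a) <= 2 ^ k.+1)%N by rewrite Lm.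
rewrite -{1}Lm; apply: le_trans (block_commons_tail x b0 lM (fun M y => hE a k M y kk ak)) _.
have mL : (2 * 2 ^ (3 * a))%:R * (2 ^ (k - 3 * a))%:R = 2 * (2 ^ k)%:R :> R.
  by rewrite -natrM Lm expnS natrM.
rewrite [leLHS](_ : _ = 4 * E / eta ^+ 2 * (a.+1%:R ^+ 2 / k%:R ^+ 2)); last first.
  rewrite [X in X / _ = _](_ : _ =
    E * ((2 * 2 ^ (3 * a))%:R * (2 ^ (k - 3 * a))%:R) ^+ 2 * a.+1%:R ^+ 2 / k%:R ^+ 4); last first.
    by field; rewrite gt_eqF.
  by rewrite mL; field; rewrite !gt_eqF// p2.
rewrite ler_wpM2l//; first by rewrite divr_ge0 ?sqr_ge0// mulr_ge0.
rewrite ler_wpM2l ?sqr_ge0// lef_pV2 ?posrE ?exprn_gt0//.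
by rewrite -!natrX ler_nat -[4%N]/(2 ^ 2)%N -expnM mulnC expnM leq_exp2r.
Qed.

End CommonTail.

Section Deviations.
Variable R : realType.

Lemma ln2_gt0 : 0 < ln 2 :> R. Proof. by rewrite ln_gt0// ltr1n. Qed.

Lemma ln2_le1 : ln 2 <= 1 :> R.
Proof. by have := @le_ln1Dx R 1; rewrite -[1 + 1]/(2%:R); apply; rewrite (lt_trans (ltrN10 R)). Qed.

Lemma ln_exp2 n : ln (2 ^ n)%:R = n%:R * ln 2 :> R.
Proof. by rewrite natrX lnXn// mulr_natl. Qed.

(** The numerical conditions that hold once [a] is large. *)
Lemma large_scale (eps : R) (n0 : nat) : 0 < eps -> exists a0 : nat, forall a k : nat,
  (a0 <= a)%N -> (2 ^ a <= k)%N ->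
  [/\ (14 * a <= k)%N, (n0 <= 2 ^ (k - 5 * a))%N, (5 * a + 1)%:R <= eps * (2 ^ a)%:R & (0 < a)%N].
Proof.
move=> e0; pose N := Num.truncn (12 / eps).
have hN : 12 / eps <= N.+1%:R by rewrite ltW// truncnS_gt.
exists (n0 + N.+1 + 28)%N => a k a0 ak.
have a2 := sqr_le_exp2 a.
have a28 : (28 <= a)%N by lia.
have ak14 : (14 * a <= k)%N.
  by rewrite (leq_trans _ ak)//; move: a2; rewrite -mulnn expnS; nia.
split=> //; last by lia.
  apply: (@leq_trans (2 ^ n0)); first by rewrite ltnW// ltn_expl.
  by rewrite leq_exp2l//; lia.
have a00 : 0 < a%:R :> R by rewrite ltr0n; lia.
have h1 : 12 <= eps * a%:R.
  rewrite mulrC -ler_pdivrMr//; apply: le_trans hN _; rewrite ler_nat; lia.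
have h2 : a%:R ^+ 2 <= 2 * (2 ^ a)%:R :> R by rewrite -natrX -natrM ler_nat -expnS.
have h3 : (5 * a + 1)%:R <= 6 * a%:R :> R by rewrite -natrM ler_nat; lia.
have h4 : eps * a%:R ^+ 2 <= eps * (2 * (2 ^ a)%:R) by rewrite ler_wpM2l// ltW.
have h5 : 12 * a%:R <= eps * a%:R * a%:R by rewrite ler_wpM2r// ltW.
by move: h4; rewrite expr2; lra.
Qed.

Lemma scale_arith (a k : nat) : (2 ^ a <= k)%N -> (14 * a <= k)%N -> (0 < a)%N ->
  [/\ (0 < k)%N, (0 < k - 5 * a)%N, (3 * a + (k - 3 * a) = k)%N &
      (k - 5 * a + 2 * a = k - 3 * a)%N] /\
  [/\ (3 * a <= k)%N, (a + (k - 3 * a) <= k)%N, (a + a.+1 <= k)%N,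
      (2 ^ a <= 2 * (k - 5 * a))%N & (k.+1 = k - 5 * a + (5 * a + 1))%N].
Proof. by move=> k1 ak a0; do !split; lia. Qed.

Variables (V : eqType) (G : lfgraph V).
Local Notation noret := (noret R G).

(** If q_n <= r / ln n eventually, it is unlikely that the range exceeds
    t n / ln n for some [n] between 2^k and 2^(k+1). *)
Lemma upper_dev (r t : R) (n0 : nat) : 0 < r -> r < t ->
  (forall n x, (n0 <= n)%N -> noret n x * ln n%:R <= r) ->
  exists2 Q : R, 0 <= Q & exists a0 : nat, forall a k x, (a0 <= a)%N ->
    (2 ^ a <= k < 2 ^ a.+1)%N ->
    pex G (2 ^ k.+1) x (fun s => (has (fun n =>
       t * n%:R < (size (undup (x :: take n s)))%:R * ln n%:R)%R
       (index_iota (2 ^ k) (2 ^ k.+1)))%:R) <= Q * (a.+1%:R ^+ 2 / 4 ^+ a).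
Proof.
move=> r0 rt hr.
(* all error terms are multiples of [eps]; the last condition on [eps] is the
   one used in [H10] *)
pose eps := Num.min 1 ((t - r) / (9 + 11 * r)).
have d0 : 0 < 9 + 11 * r by rewrite addr_gt0// mulr_gt0.
have eps0 : 0 < eps by rewrite lt_min ltr01 divr_gt0// subr_gt0.
have eps1 : eps <= 1 by rewrite ge_min lexx.
have epst : eps * (9 + 11 * r) <= t - r by rewrite -ler_pdivlMr// ge_min lexx orbT.
have [a0 ha0] := large_scale n0 eps0.
pose th := eps / 4.
have th0 : th != 0 by rewrite gt_eqF// divr_gt0.
have th1 : `|th| <= 2^-1 by rewrite ger0_norm ?divr_ge0 ?(ltW eps0)// /th; lra.
have Q0 : 0 <= 54 / (th ^+ 2 * r) ^+ 3.
  by rewrite divr_ge0// exprn_ge0// mulr_ge0 ?sqr_ge0 ?(ltW r0).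
exists (54 / (th ^+ 2 * r) ^+ 3) => //.
exists a0 => a k x aa0 kk; have /andP[k1 k2] := kk.
have [ak n0k epsa a_gt0] := ha0 a k aa0 k1.
have l2 := ln2_gt0; have l21 := ln2_le1.
have [[k0 k5 ek e53] [a3k ea3 eaa e25 ek1]] := scale_arith k1 ak a_gt0.
have kR : 0 < k%:R :> R by rewrite ltr0n.
have kaR : 0 < (k - 5 * a)%:R :> R by rewrite ltr0n.
set m := (2 ^ (k - 3 * a))%N; set L := (2 ^ (3 * a))%N.
have p2 j : 0 < (2 ^ j)%:R :> R by rewrite ltr0n expn_gt0.
have m0 : 0 < m%:R :> R by rewrite p2.
have Lm : (L * m = 2 ^ k)%N by rewrite -expnD ek.
pose j := (2 ^ (k - 5 * a))%N.
pose b := r / ((k - 5 * a)%:R * ln 2).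
(* upper estimate of the mean range of a block, divided by [m]: the first [j]
   steps, j / m = 4^-a, plus the return probability at time [j] *)
pose q := 4 ^- a + b.
have b0 : 0 < b by rewrite divr_gt0// mulr_gt0.
have i4 : 0 < 4 ^- a :> R by rewrite invr_gt0 exprn_gt0.
have noret_b y : noret j y <= b.
  by rewrite ler_pdivlMr ?mulr_gt0// -ln_exp2 hr.
have mean_q y : th * mean_range R G m y <= th * (q * m%:R).
  rewrite ler_wpM2l ?divr_ge0 ?(ltW eps0)//.
  apply: le_trans (mean_range_le m y (ltW b0) noret_b) _.
  rewrite /q mulrDl [b * _]mulrC lerD2r.
  rewrite mulrC ler_pdivlMr ?exprn_gt0// -natrX -natrM ler_nat /j /m.
  by rewrite -[4%N]/(2 ^ 2)%N -expnM -expnD e53.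
have rq : r / k%:R <= q.
  apply: (le_trans (y := b)); last by rewrite /q lerDr ltW.
  rewrite /b ler_wpM2l ?(ltW r0)// lef_pV2 ?posrE ?mulr_gt0//.
  apply: (le_trans (y := (k - 5 * a)%:R * 1)); first by rewrite ler_wpM2l.
  by rewrite mulr1 ler_nat leq_subr.
apply: le_trans (le_trans (chernoff_union x kk _ th1 th0 r0 rq mean_q) _); last 2 first.
- exact: a3k.
- rewrite ler_wpM2l//; rewrite ler_peMl ?(ltW i4)// -natrX ler1n expn_gt0//.
apply: le_pex => s ss; rewrite ler_nat -/m -/L.
case: (boolP (has _ (index_iota L _))) => [_|/hasPn good]; first exact: leq_b1.
rewrite leqn0 eqb0; apply/hasPn => n; rewrite mem_index_iota => /andP[n1 n2].
rewrite -leNgt.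
have m0' : (0 < m)%N by rewrite expn_gt0.
(* [l] blocks cover the first [n] steps *)
pose l := (n %/ m).+1.
have Ll : (L <= n %/ m)%N by rewrite leq_divRL// Lm.
have lL : (l <= 2 * L)%N by rewrite /l ltn_divLR// -mulnA Lm -expnS.
have nl : (n < l * m)%N by rewrite /l ltn_ceil.
have ln_ : (l * m <= n + m)%N by rewrite /l mulSn addnC leq_add2r leq_trunc_div.
have := good l; rewrite mem_index_iota ltnS lL andbT (leq_trans Ll (leqnSn _)).
move=> /(_ isT); rewrite -ltNge ltr_pM2l ?divr_gt0// ltr_pdivrMr// => H.
have th4 : 4 * th = eps by rewrite /th mulrC divfK.
rewrite th4 in H.
have n0' : 0 < n%:R :> R by rewrite ltr0n (leq_trans _ n1)// expn_gt0.
have H1 : (size (undup (x :: take n s)))%:R <= 1 + (block_ranges m l s)%:R :> R.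
  rewrite [leRHS]addrC natr1 ler_nat.
  apply: leq_trans (size_undup_cat_le [:: x] _) _.
  by rewrite -[size (undup [:: x])]/1%N add1n ltnS range_le_blocks// ltnW.
have q0 : 0 < q by rewrite addr_gt0.
have en : 1 <= eps * (2 ^ a)%:R by apply: le_trans epsa; rewrite ler1n addn1.
have H2 : m%:R <= eps * n%:R.
  apply: (le_trans (y := eps * (2 ^ a)%:R * m%:R)); first by rewrite ler_peMl// ltW.
  rewrite -mulrA ler_wpM2l ?(ltW eps0)// -natrM ler_nat (leq_trans _ n1)//.
  by rewrite /m -expnD leq_exp2l.
have H3 : k.+1%:R <= eps * n%:R.
  apply: (le_trans (y := eps * (2 ^ a)%:R * k.+1%:R)); first by rewrite ler_peMl// ltW.
  rewrite -mulrA ler_wpM2l ?(ltW eps0)// -natrM ler_nat (leq_trans _ n1)//.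
  apply: (@leq_trans (2 ^ a * 2 ^ a.+1)); first by rewrite leq_mul2l k2 orbT.
  by rewrite -expnD leq_exp2l.
have H4 : l%:R * m%:R <= (1 + eps) * n%:R :> R.
  rewrite mulrDl mul1r -natrM (le_trans (y := (n + m)%:R)) ?ler_nat// natrD lerD2l//.
have H5 : ln n%:R <= k.+1%:R * ln 2 :> R.
  by rewrite -ln_exp2 ler_ln ?posrE// ?p2// ler_nat ltnW.
have H6 : q * (k.+1%:R * ln 2) <= 2 * eps + r * (1 + 2 * eps).
  rewrite /q mulrDl lerD//.
    apply: (le_trans (y := 4 ^- a * (2 ^ a.+1)%:R)).
      rewrite ler_wpM2l ?(ltW i4)// -[leRHS]mulr1 ler_pM ?(ltW l2)// ler_nat//.
    rewrite mulrC ler_pdivrMr ?exprn_gt0// (_ : 4 ^+ a = (2 ^ a)%:R * (2 ^ a)%:R :> R); last first.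
      by rewrite -natrX -natrM -expnD -[4%N]/(2 ^ 2)%N -expnM mul2n addnn.
    rewrite expnS natrM mulrA -[2 * eps * _]mulrA ler_wpM2r// ?(ltW (p2 _))//.
    by rewrite -[leLHS]mulr1 ler_wpM2l.
  rewrite /b [leLHS](_ : _ = r * (k.+1%:R / (k - 5 * a)%:R)); last first.
    by field; rewrite !gt_eqF.
  rewrite ler_wpM2l ?(ltW r0)// ler_pdivrMr//.
  have : eps * (2 ^ a)%:R <= eps * (2 * (k - 5 * a)%:R).
    by rewrite ler_wpM2l ?(ltW eps0)// -natrM ler_nat.
  have : k.+1%:R = (k - 5 * a)%:R + (5 * a + 1)%:R :> R.
    by rewrite -natrD -ek1.
  move=> -> h; rewrite mulrDl mul1r lerD2l; apply: le_trans epsa (le_trans h _).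
  by rewrite mulrA [eps * 2]mulrC.
have H7 : 0 <= k.+1%:R * ln 2 :> R by rewrite mulr_ge0// ltW.
apply: (le_trans (y := (1 + (1 + eps) * q * ((1 + eps) * n%:R)) * (k.+1%:R * ln 2))).
  rewrite ler_pM// ?ln_ge0 ?ler1n ?ltr0n//.
    by rewrite -(ltr0n R).
  apply: le_trans H1 _; rewrite lerD2l; apply: le_trans (ltW H) _.
  rewrite -[leLHS]mulrA; apply: ler_wpM2l; last exact: H4.
  by apply: mulr_ge0; [apply: addr_ge0; [exact: ler01|exact: ltW]|exact: ltW].
rewrite mulrDl mul1r.
have H8 : k.+1%:R * ln 2 <= eps * n%:R.
  by apply: le_trans H3; rewrite -[leRHS]mulr1 ler_wpM2l.
have H9 : (1 + eps) ^+ 2 * (q * (k.+1%:R * ln 2)) <= (1 + 3 * eps) * (2 * eps + r * (1 + 2 * eps)).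
  apply: ler_pM; rewrite ?sqr_ge0 ?mulr_ge0 ?(ltW q0) ?(ltW l2)//.
  have : eps * eps <= eps by rewrite -[leRHS]mulr1 ler_wpM2l ?(ltW eps0).
  by rewrite expr2; lra.
have H10 : eps + (1 + 3 * eps) * (2 * eps + r * (1 + 2 * eps)) <= t.
  have : eps * eps <= eps by rewrite -[leRHS]mulr1 ler_wpM2l ?(ltW eps0).
  have : r * (eps * eps) <= r * eps.
    by rewrite ler_wpM2l ?(ltW r0)// -[leRHS]mulr1 ler_wpM2l ?(ltW eps0).
  by lra.
apply: (le_trans (y := (eps + (1 + eps) ^+ 2 * (q * (k.+1%:R * ln 2))) * n%:R)).
  by rewrite [leRHS]mulrDl lerD// le_eqVlt; apply/orP; left; apply/eqP; ring.
by rewrite ler_wpM2r//; lra.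
Qed.

End Deviations.

(** * Lower deviations *)
Section LowerDeviation.
Variables (R : realType) (V : eqType) (G : lfgraph V).
Variables (D : nat) (C c : R).
Hypothesis deg_le : forall x, (size (G x) <= D)%N.
Hypothesis C_ge0 : 0 <= C.
Hypothesis c_gt0 : 0 < c.
Hypothesis hk_upper : forall n x y, (0 < n)%N -> hk R G n x y <= C / n%:R.
Hypothesis hk_lower : forall n x, (0 < n)%N -> c / n%:R <= hk R G n x x + hk R G n.+1 x x.

(** If q_n >= r / ln n eventually, it is unlikely that the range is below
    t n / ln n for some [n] between 2^k and 2^(k+1). *)
Lemma lower_dev (r t : R) (n0 : nat) : 0 < t -> t < r ->
  (forall n x, (n0 <= n)%N -> r <= noret R G n x * ln n%:R) ->
  exists2 Q : R, 0 <= Q & exists a0 : nat, forall a k x, (a0 <= a)%N ->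
    (2 ^ a <= k < 2 ^ a.+1)%N ->
    pex G (2 ^ k.+1) x (fun s => (has (fun n =>
       (size (undup (x :: take n s)))%:R * ln n%:R < t * n%:R)%R
       (index_iota (2 ^ k) (2 ^ k.+1)))%:R) <= Q * (a.+1%:R ^+ 2 / 4 ^+ a).
Proof.
move=> t0 tr hr; have r0 := lt_trans t0 tr.
pose eps := Num.min 1 ((r - t) / (4 * r)).
pose eta := (r - t) / 2.
have eta0 : 0 < eta by rewrite divr_gt0// subr_gt0.
have eps0 : 0 < eps by rewrite lt_min ltr01 divr_gt0 ?subr_gt0// mulr_gt0.
have eps1 : eps <= 1 by rewrite ge_min lexx.
have epst : eps * (4 * r) <= r - t by rewrite -ler_pdivlMr ?mulr_gt0// ge_min lexx orbT.
have [a0 ha0] := large_scale n0 eps0.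
have [E E0 hE] := common_tail deg_le C_ge0 c_gt0 hk_upper hk_lower eta0.
pose th := - (eps / 4).
have th0 : th != 0 by rewrite oppr_eq0 gt_eqF// divr_gt0.
have th1 : `|th| <= 2^-1.
  rewrite normrN ger0_norm ?divr_ge0 ?(ltW eps0)// ler_pdivrMr//.
  by apply: le_trans eps1 _; rewrite (_ : 2^-1 * 4 = 2) ?ler1n//; field.
have Q0 : 0 <= 54 / (th ^+ 2 * r) ^+ 3.
  by rewrite divr_ge0// exprn_ge0// mulr_ge0 ?sqr_ge0 ?(ltW r0).
exists (54 / (th ^+ 2 * r) ^+ 3 + E); first by rewrite addr_ge0.
exists a0 => a k x aa0 kk; have /andP[k1 k2] := kk.
have [ak n0k epsa a_gt0] := ha0 a k aa0 k1.
have l2 := ln2_gt0 R; have l21 := ln2_le1 R.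
have [[k0 k5 ek e53] [a3k ea3 eaa e25 ek1]] := scale_arith k1 ak a_gt0.
have kR : 0 < k%:R :> R by rewrite ltr0n.
set m := (2 ^ (k - 3 * a))%N; set L := (2 ^ (3 * a))%N.
have p2 j : 0 < (2 ^ j)%:R :> R by rewrite ltr0n expn_gt0.
have m0 : 0 < m%:R :> R by rewrite p2.
have Lm : (L * m = 2 ^ k)%N by rewrite -expnD ek.
pose q := r / (k%:R * ln 2).
have q0 : 0 < q by rewrite divr_gt0// mulr_gt0.
have n0m : (n0 <= m)%N.
  apply: leq_trans n0k _; rewrite leq_exp2l// leq_sub2l// leq_mul2r orbT//.
have noret_q y : q <= noret R G m y.
  rewrite ler_pdivrMr ?mulr_gt0//; apply: le_trans (hr m y n0m) _.
  rewrite ler_wpM2l ?noret_ge0// ln_exp2 ler_wpM2r ?(ltW l2)// ler_nat leq_subr//.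
have mean_q y : th * mean_range R G m y <= th * (q * m%:R).
  rewrite !mulNr lerN2 ler_wpM2l ?divr_ge0 ?(ltW eps0)// mulrC.
  exact: mean_range_ge.
have rq : r / k%:R <= q.
  rewrite /q ler_wpM2l ?(ltW r0)// lef_pV2 ?posrE ?mulr_gt0//.
  by rewrite -[leRHS]mulr1 ler_wpM2l.
rewrite mulrDl.
have tail1 : pex G (2 ^ k.+1) x (fun s => (has (fun l : nat =>
      th * ((1 + 4 * th) * q * l%:R) <=
      th * ((block_ranges m l s)%:R / m%:R))%R
      (index_iota L (2 * L).+1))%:R) <= 54 / (th ^+ 2 * r) ^+ 3 * (a.+1%:R ^+ 2 / 4 ^+ a).
  apply: le_trans (chernoff_union x kk a3k th1 th0 r0 rq mean_q) _.
  rewrite ler_wpM2l// ler_peMl ?invr_ge0 ?exprn_ge0// -natrX ler1n expn_gt0//.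
have tail2 := hE a k x kk ak.
apply: le_trans (lerD tail1 tail2).
rewrite -pexD; apply: le_pex => s ss; rewrite -natrD ler_nat -/m -/L.
case: (boolP (has _ (index_iota L _))) => [_|/hasPn good].
  by rewrite (leq_trans (leq_b1 _))// leq_addr.
case: (boolP (_ <= _)) => [_|]; first by rewrite leq_b1.
rewrite -ltNge => goodJ; rewrite leqn0 eqb0; apply/hasPn => n.
rewrite mem_index_iota => /andP[n1 n2]; rewrite -leNgt.
have m0' : (0 < m)%N by rewrite expn_gt0.
(* the number of complete blocks in the first [n] steps *)
have [l lE] : exists l, l = (n %/ m)%N by exists (n %/ m)%N.
have Ll : (L <= l)%N by rewrite lE leq_divRL// Lm.
have lL : (l <= 2 * L)%N by rewrite ltnW// lE ltn_divLR// -mulnA Lm -expnS.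
have ln_ : (l * m <= n)%N by rewrite lE leq_trunc_div.
have nl : (n <= l * m + m)%N by rewrite addnC -mulSn lE ltnW// ltn_ceil.
have := good l; rewrite mem_index_iota ltnS lL Ll => /(_ isT).
rewrite -ltNge ltr_nM2l ?oppr_lt0 ?divr_gt0// ltr_pdivlMr// => H.
have th4 : 4 * th = - eps by rewrite /th mulrN mulrC divfK.
rewrite th4 in H.
have n0' : 0 < n%:R :> R by rewrite ltr0n (leq_trans _ n1)// expn_gt0.
have sl : size s = (2 * L * m)%N by rewrite ss -mulnA Lm -expnS.
have H1 : (block_ranges m l s)%:R - (block_commons m (2 * L) s)%:R
     <= (size (undup (x :: take n s)))%:R :> R.
  rewrite lerBlDr -natrD ler_nat.
  apply: leq_trans (blocks_le_range lL sl) _; rewrite leq_add2r.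
  apply: le_size_undup => y; rewrite inE -{1}(minn_idPl ln_) take_min => /mem_take ->.
  by rewrite orbT.
have en : 1 <= eps * (2 ^ a)%:R by apply: le_trans epsa; rewrite ler1n addn1.
have H2 : m%:R <= eps * n%:R.
  apply: (le_trans (y := eps * (2 ^ a)%:R * m%:R)); first by rewrite ler_peMl// ltW.
  rewrite -mulrA ler_wpM2l ?(ltW eps0)// -natrM ler_nat (leq_trans _ n1)//.
  by rewrite /m -expnD leq_exp2l.
have H4 : (1 - eps) * n%:R <= l%:R * m%:R :> R.
  rewrite mulrBl mul1r lerBlDr -natrM (le_trans (y := (l * m + m)%:R)) ?ler_nat//.
  by rewrite natrD lerD2l.
have H5 : k%:R * ln 2 <= ln n%:R :> R.
  by rewrite -ln_exp2 ler_ln ?posrE// ?p2// ler_nat.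
have e10 : 0 <= 1 - eps by rewrite subr_ge0.
have H6 : (1 - eps) * q * ((1 - eps) * n%:R) - eta * n%:R / k%:R <=
   (size (undup (x :: take n s)))%:R :> R.
  apply: le_trans _ H1; apply: lerB.
    apply: le_trans _ (ltW H); rewrite -[leRHS]mulrA; apply: ler_wpM2l => //.
    by apply: mulr_ge0 => //; exact: ltW.
  apply: le_trans (ltW goodJ) _.
  by rewrite ler_wpM2r ?invr_ge0 ?(ltW kR)// ler_wpM2l ?(ltW eta0)// ler_nat.
have kl0 : 0 < k%:R * ln 2 :> R by rewrite mulr_gt0.
apply: (le_trans (y := (size (undup (x :: take n s)))%:R * (k%:R * ln 2))); last first.
  by rewrite ler_wpM2l.
apply: le_trans _ (ler_wpM2r (ltW kl0) H6).
rewrite [leRHS](_ : _ = ((1 - eps) * (1 - eps) * r - eta * ln 2) * n%:R); last first.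
  by rewrite /q; field; rewrite !gt_eqF.
rewrite ler_wpM2r//.
have HA : eta * ln 2 <= eta by rewrite -[leRHS]mulr1 ler_wpM2l ?(ltW eta0).
have HB : (1 - 2 * eps) * r <= (1 - eps) * (1 - eps) * r.
  rewrite ler_wpM2r ?(ltW r0)// -subr_ge0 (_ : _ - _ = eps * eps); last by ring.
  by rewrite mulr_ge0 ?(ltW eps0).
have HC : 2 * eta = r - t by rewrite /eta mulrC divfK.
move: (eta * ln 2) HA ((1 - eps) * (1 - eps) * r) HB => u HA v HB.
by lra.
Qed.

End LowerDeviation.

(** * Volume growth and on-diagonal bounds *)
Section Geometry.
Variables (R : realType) (V : choiceType) (e : rel V).

(** [set_size] is 0 on infinite sets, so a lower volume bound entails finiteness. *)
Lemma set_size_gt0_finite (A : set V) : (0 < set_size A)%N -> finite_set A.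
Proof.
move=> A0; case: (pselect (finite_set A)) => // nA.
by move: A0; rewrite /set_size /fset_set; case: pselect => //; rewrite cardfs0.
Qed.

Lemma le_set_size (A B : set V) : finite_set B -> A `<=` B ->
  (set_size A <= set_size B)%N.
Proof.
move=> fB AB; have fA := sub_finite_set AB fB.
by apply: fsubset_leq_card; rewrite -fset_set_sub.
Qed.

Lemma le_ball x (r1 r2 : R) : r1 <= r2 -> graph_ball e x r1 `<=` graph_ball e x r2.
Proof. by move=> rr y /= h; exact: le_trans rr. Qed.

Variable d : R.
Hypothesis d_gt1 : 1 < d.
Hypothesis regular : ahlfors_regular e d.

Lemma ball_finite x (r : R) : finite_set (graph_ball e x r).
Proof.
have [c1 [c2 [c10 c20 H]]] := regular.
have [N rN] : exists N : nat, r <= N.+1%:R.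
  exists (Num.truncn r); case: (ltP r 0) => r0; first by rewrite ltW// (lt_le_trans r0).
  by rewrite ltW// truncnS_gt.
apply: sub_finite_set (le_ball rN) _; apply: set_size_gt0_finite.
have /andP[H1 _] := H N.+1 x isT.
by rewrite -(ltr0n R); apply: lt_le_trans H1; rewrite mulr_gt0// powR_gt0.
Qed.

Lemma vertices_countable (x : V) : countable [set: V].
Proof.
have -> : [set: V] = \bigcup_(n in [set: nat]) graph_ball e x (n%:R : R).
  by apply/seteqP; split => // y _; exists (graph_dist e x y) => //=; rewrite /graph_ball /= lexx.
apply: bigcup_countable => // n _; exact/finite_set_countable/ball_finite.
Qed.

(** The radius n^(1/d) is compared with the integers just below and above it. *)
Lemma volume_bounds : exists v1 v2 : R, [/\ 0 < v1, 0 < v2 & forall (n : nat) x, (0 < n)%N ->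
  v1 * n%:R <= (set_size (graph_ball e x (n%:R `^ d^-1)))%:R <= v2 * n%:R].
Proof.
have [c1 [c2 [c10 c20 H]]] := regular.
have d0 : 0 < d by rewrite (lt_trans _ d_gt1).
exists (c1 * 2^-1 `^ d), (c2 * 2 `^ d).
split; rewrite ?mulr_gt0 ?powR_gt0//.
move=> n x n0; set rho := n%:R `^ d^-1.
have n1 : 1 <= n%:R :> R by rewrite ler1n.
have rho1 : 1 <= rho by rewrite -(powRr0 n%:R) /rho ler_powR// invr_ge0 ltW.
have rhod : rho `^ d = n%:R by rewrite /rho -powRrM mulVf ?gt_eqF// powRr1// (le_trans ler01).
have rho0 : 0 <= rho by rewrite (le_trans ler01).
have := truncn_itv rho0; set N := Num.truncn rho => /andP[N1 N2].
have NN : (1 <= N)%N.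
  rewrite lt0n; apply/eqP => N0; move: N2; rewrite N0 => r1.
  by move: (le_lt_trans rho1 r1); rewrite ltxx.
have NR : 1 <= N%:R :> R by rewrite ler1n.
apply/andP; split.
  have /andP[H1 _] := H N x NN.
  apply: (le_trans (y := c1 * N%:R `^ d)).
    rewrite -mulrA ler_wpM2l ?(ltW c10)// -rhod -powRM// ?invr_ge0//.
    apply: ge0_ler_powR; rewrite ?nnegrE ?(ltW d0)//; first by rewrite mulr_ge0 ?invr_ge0.
    by move: N2; rewrite -natr1; lra.
  apply: le_trans H1 _; rewrite ler_nat; apply: le_set_size (le_ball N1); exact: ball_finite.
have /andP[_ H2] := H N.+1 x isT.
apply: (le_trans (y := c2 * N.+1%:R `^ d)).
  apply: le_trans _ H2; rewrite ler_nat; apply: le_set_size (le_ball (ltW N2)); exact: ball_finite.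
rewrite -mulrA ler_wpM2l ?(ltW c20)// -rhod -powRM//.
apply: ge0_ler_powR; rewrite ?nnegrE ?(ltW d0)//; first by rewrite mulr_ge0.
by move: N1; rewrite -natr1; lra.
Qed.

Hypothesis e_conn : connected_graph e.

Lemma graph_dist_xx x : graph_dist e x x = 0%N.
Proof.
rewrite /graph_dist; case: xgetP => [n -> [_ /(_ 0%N)]|//].
suff w0 : walk e 0 x x by move=> /(_ w0); rewrite leqn0 => /eqP.
by exists [::].
Qed.

Hypothesis e_sym : symmetric e.
Hypothesis V_inf : infinite_set [set: V].
Hypothesis e_deg : bounded_degrees e.

Lemma neighbours_finite x : finite_set (neighbours e x).
Proof. by have [D /(_ x) H] := e_deg; exact: card_le_finite H (finite_II D). Qed.

Lemma degree_gt0 x : (0 < degree e x)%N.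
Proof.
have [y xy] : exists y, y != x.
  apply: contrapT => H; apply: V_inf.
  suff -> : [set: V] = [set x] by exact: finite_set1.
  apply/seteqP; split => // y _ /=; apply/eqP/negPn/negP => yx; apply: H; by exists y.
have [n [[|z p] [/= pp lp sp]]] := e_conn x y; first by rewrite lp eqxx in xy.
rewrite /degree /set_size cardfs_gt0; apply/fset0Pn; exists z.
by rewrite in_fset_set ?inE/=; [case/andP: pp|exact: neighbours_finite].
Qed.

Lemma walk_graph : exists2 G : lfgraph V,
  (forall x y, (y \in G x) = e x y) /\ (forall x, degree e x = size (G x)) &
  exists D, forall x, (size (G x) <= D)%N.
Proof.
pose nb x : seq V := fset_set (neighbours e x).
have nbE x y : (y \in nb x) = e x y.
  by rewrite /nb in_fset_set ?mem_setE//; exact: neighbours_finite.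
have nb_uniq x : uniq (nb x) by exact: fset_uniq.
have nb_sym x y : (y \in nb x) = (x \in nb y) by rewrite !nbE e_sym.
have nb_gt0 x : (0 < size (nb x))%N by exact: degree_gt0.
exists (LFGraph nb_uniq nb_sym nb_gt0) => //.
have [D H] := e_deg; exists D => x; exact: geq_card_fset_set (H x).
Qed.

End Geometry.

Section OnDiagonal.
Variables (R : realType) (V : choiceType) (e : rel V) (d : R).
Variables (disp : measure_display) (Omega : measurableType disp).
Variables (S : nat -> Omega -> V) (P : V -> probability Omega R).
Hypothesis d_gt1 : 1 < d.
Hypothesis regular : ahlfors_regular e d.

Lemma heat_kernel_le : sub_gaussian_upper e S P d -> exists2 C : R, 0 <= C &
  forall n x y, (0 < n)%N -> heat_kernel S P n x y <= C / n%:R.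
Proof.
move=> [c3 [c4 [c30 c40 H]]]; have [v1 [v2 [v10 v20 Hv]]] := volume_bounds d_gt1 regular.
exists (c3 / v1); first by rewrite divr_ge0 ?ltW.
move=> n x y n0; apply: le_trans (H n x y n0) _; rewrite /sub_gaussian.
have nR : 0 < n%:R :> R by rewrite ltr0n.
have /andP[V1 _] := Hv n x n0.
have p : 0 < v1 * n%:R by rewrite mulr_gt0.
rewrite -[leRHS]mulr1; apply: ler_pM; rewrite ?expR_ge0 ?divr_ge0 ?(ltW c30)//.
  by rewrite -mulrA -invfM ler_wpM2l ?(ltW c30)// lef_pV2 ?posrE// (lt_le_trans p).
by rewrite -[leRHS]expR0 ler_expR oppr_le0 mulr_ge0 ?(ltW c40)// divr_ge0 ?powR_ge0.
Qed.

Lemma heat_kernel_diag_ge : sub_gaussian_lower e S P d -> exists2 c : R, 0 < c &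
  forall n x, (0 < n)%N -> c / n%:R <= heat_kernel S P n x x + heat_kernel S P n.+1 x x.
Proof.
move=> [c5 [c6 [c50 c60 H]]]; have [v1 [v2 [v10 v20 Hv]]] := volume_bounds d_gt1 regular.
exists (c5 / v2); first by rewrite divr_gt0.
move=> n x n0; have := H n x x n0; rewrite graph_dist_xx => /(_ isT) {}H.
apply: le_trans _ H; rewrite /sub_gaussian graph_dist_xx powR0; last first.
  by rewrite mulf_neq0 ?invr_neq0 ?gt_eqF ?subr_gt0// (lt_trans ltr01).
rewrite mul0r mulr0 oppr0 expR0 mulr1 -mulrA -invfM.
have nR : 0 < n%:R :> R by rewrite ltr0n.
have /andP[V1 V2] := Hv n x n0.
rewrite ler_wpM2l ?(ltW c50)// lef_pV2 ?posrE ?mulr_gt0//.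
by rewrite (lt_le_trans _ V1)// mulr_gt0.
Qed.

End OnDiagonal.

(** * The law of the process on finite paths *)
Section PathLaw.
Variables (R : realType) (V : choiceType) (e : rel V).
Variables (disp : measure_display) (Omega : measurableType disp).
Variables (S : nat -> Omega -> V) (P : V -> probability Omega R).
Hypothesis srw : simple_random_walk e S P.
Hypothesis V_count : countable [set: V].
Variable G : lfgraph V.
Hypothesis GE : forall x y, (y \in G x) = e x y.
Hypothesis Gdeg : forall x, degree e x = size (G x).

(** The piece S_i, ..., S_{i+n-1} of the trajectory. *)
Definition traj (i n : nat) (w : Omega) : seq V := [seq S k w | k <- iota i n].

Lemma size_traj i n w : size (traj i n w) = n.
Proof. by rewrite size_map size_iota. Qed.

Lemma trajS i n w : traj i n.+1 w = S i w :: traj i.+1 n w.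
Proof. by []. Qed.

Lemma traj_rcons i n w : traj i n.+1 w = rcons (traj i n w) (S (i + n)%N w).
Proof. by rewrite /traj -addn1 iotaD map_cat cats1. Qed.

(** Only the sets [S n @^-1` A] are assumed measurable; countability of the vertex
    set is what allows combining several times. *)
Lemma measurable_traj i n (Q : set (seq V)) : measurable [set w | Q (traj i n w)].
Proof.
elim: n i Q => [|n IH] i Q.
  case: (pselect (Q [::])) => HQ.
    by rewrite (_ : [set w | _] = setT)//; apply/seteqP; split.
  by rewrite (_ : [set w | _] = set0)//; apply/seteqP; split.
have /countable_injP[f finj] := V_count.
have fi y z : f y = f z -> y = z by move=> fyz; apply: finj => //; rewrite inE.
rewrite (_ : [set w | _] = \bigcup_(j in [set: nat])
    [set w | f (S i w) = j /\ Q (S i w :: traj i.+1 n w)]); last first.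
  by apply/seteqP; split => w /=; [move=> Qw; exists (f (S i w))|case=> j _ []].
apply: bigcup_measurable => j _.
case: (pselect (exists y, f y = j)) => [[y fy]|H]; last first.
  rewrite (_ : [set w | _] = set0)//; apply/seteqP; split => // w /= [fj _].
  by apply: H; exists (S i w).
rewrite (_ : [set w | _] = (S i @^-1` [set y]) `&` [set w | Q (y :: traj i.+1 n w)]).
  by apply: measurableI; [exact: (srw_measurable srw)|exact: (IH _ (fun s => Q (y :: s)))].
apply/seteqP; split => w /=.
  by move=> [fj QS]; have <- : S i w = y by apply: fi; rewrite fj fy.
by move=> [-> QS]; split.
Qed.

(** The probability of an event under [P x], as a real number. *)
Definition pr x (A : set Omega) : R := fine (P x A).

Lemma prE x A : measurable A -> P x A = (pr x A)%:E.
Proof. by move=> mA; rewrite /pr fineK// fin_num_measure. Qed.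

Lemma pr_ge0 x A : 0 <= pr x A. Proof. by rewrite fine_ge0. Qed.

Lemma prT x : pr x setT = 1. Proof. by rewrite /pr probability_setT. Qed.

Lemma pr0 x : pr x set0 = 0. Proof. by rewrite /pr measure0. Qed.

Lemma prU x A B : measurable A -> measurable B -> A `&` B = set0 ->
  pr x (A `|` B) = pr x A + pr x B.
Proof.
move=> mA mB AB; apply: EFin_inj; rewrite EFinD -!prE//; last exact: measurableU.
by rewrite measureU//; apply/eqP.
Qed.

Lemma le_pr x A B : measurable A -> measurable B -> A `<=` B -> pr x A <= pr x B.
Proof.
by move=> mA mB AB; rewrite -lee_fin -!prE//; apply: le_measure; rewrite ?inE.
Qed.

Lemma pr_split x A B : measurable A -> measurable B ->
  pr x A = pr x (A `&` B) + pr x (A `\` B).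
Proof.
move=> mA mB; rewrite -prU; last 3 first.
- exact: measurableI.
- exact: measurableD.
- by apply/seteqP; split => // w [[_ Bw] [_ /(_ Bw)]].
congr (pr x _); apply/seteqP; split => w /=; last by case=> -[].
by move=> Aw; case: (pselect (B w)) => Bw; [left|right].
Qed.

Lemma prI1 x A B : measurable A -> measurable B -> pr x B = 1 -> pr x (A `&` B) = pr x A.
Proof.
move=> mA mB B1; rewrite (pr_split x mA mB).
suff -> : pr x (A `\` B) = 0 by rewrite addr0.
have := pr_split x measurableT mB; rewrite prT setTI B1 => H.
apply/le_anti; rewrite pr_ge0 andbT; apply: (le_trans (y := pr x (setT `\` B))); last by lra.
by apply: le_pr; [exact: measurableD|exact: measurableD|move=> w []].
Qed.

(** The event that the trajectory starts with [u]. *)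
Definition cyl (u : seq V) : set Omega := [set w | traj 0 (size u) w = u].

Lemma measurable_cyl u : measurable (cyl u).
Proof. exact: (measurable_traj 0 (size u) (fun s => s = u)). Qed.

Lemma cylP x0 u : cyl u = [set w | forall k, (k < size u)%N -> S k w = nth x0 u k].
Proof.
apply/seteqP; split => w; rewrite /cyl /=.
  move=> wu k ku; rewrite -{1}wu (nth_map 0%N) ?size_iota// nth_iota//.
move=> H; apply: (@eq_from_nth _ x0); first by rewrite size_traj.
by move=> k; rewrite size_traj => ku; rewrite (nth_map 0%N) ?size_iota// nth_iota// H.
Qed.

Lemma pr_cyl_step x u z y :
  pr x (cyl (rcons (rcons u z) y)) =
  pr x (cyl (rcons u z)) * (if y \in G z then (size (G z))%:R^-1 else 0).
Proof.
apply: EFin_inj; rewrite EFinM -!prE; [|exact: measurable_cyl..].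
have := srw_step srw x (size u) (nth x (rcons (rcons u z) y)).
rewrite /step_prob (_ : nth x (rcons (rcons u z) y) (size u) = z); last first.
  by rewrite nth_rcons size_rcons ltnS leqnn nth_rcons ltnn eqxx.
rewrite (_ : nth x (rcons (rcons u z) y) (size u).+1 = y); last first.
  by rewrite nth_rcons size_rcons ltnn eqxx.
rewrite GE -Gdeg => H.
have -> : cyl (rcons (rcons u z) y) = [set w | forall k, (k <= (size u).+1)%N ->
    S k w = nth x (rcons (rcons u z) y) k].
  by rewrite (cylP x) !size_rcons.
have -> : cyl (rcons u z) = [set w | forall k, (k <= size u)%N ->
    S k w = nth x (rcons (rcons u z) y) k].
  rewrite (cylP x) size_rcons; apply/seteqP; split => w /= Sw k kz.
    by rewrite Sw// [RHS]nth_rcons size_rcons ltnS kz.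
  by rewrite Sw// nth_rcons size_rcons kz.
exact: H.
Qed.

Lemma pr_sum_next x (B : set Omega) i (r : seq V) : measurable B -> uniq r ->
  \sum_(y <- r) pr x (B `&` [set w | S i w = y]) <= pr x B.
Proof.
move=> mB; have mS A : measurable (S i @^-1` A) by exact: (srw_measurable srw).
suff H : uniq r -> \sum_(y <- r) pr x (B `&` [set w | S i w = y]) =
   pr x (B `&` [set w | S i w \in r]).
  move=> /H ->; apply: le_pr => //.
  by apply: measurableI => //; exact: (mS (fun y => y \in r)).
elim: r => [_|y r IH /= /andP[yr ur]].
  by rewrite big_nil (_ : _ `&` _ = set0) ?pr0//; apply/seteqP; split => // w [].
rewrite big_cons IH// -prU; last 3 first.
- by apply: measurableI => //; exact: (mS [set y]).
- by apply: measurableI => //; exact: (mS (fun y => y \in r)).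
- by apply/seteqP; split => // w [[_ /= Sy] [_ /=]]; rewrite Sy (negPf yr).
congr (pr x _); rewrite -setIUr; congr (_ `&` _).
apply/seteqP; split => w /=; rewrite in_cons; first by case=> [->|->]; rewrite ?eqxx ?orbT.
by case/orP => [/eqP|]; [left|right].
Qed.

Lemma measurable_trajb i n (Q : seq V -> bool) : measurable [set w | Q (traj i n w)].
Proof. exact: (measurable_traj i n (fun s => Q s)). Qed.

(** Let [A] be an event whose conditional probability given that the trajectory
    starts with [rcons u z] depends only on [z], namely [phi z]. *)
Section MarkovEvent.
Variables (x : V) (A : set Omega) (phi : V -> R).
Hypothesis mA : measurable A.
Hypothesis cyl_phi : forall u z, pr x (cyl (rcons u z) `&` A) = pr x (cyl (rcons u z)) * phi z.

Lemma markov_event_ge n u z (Q : seq V -> bool) :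
  pr x (cyl (rcons u z)) * pex G n z (fun s => (Q s)%:R * phi (last z s)) <=
  pr x (cyl (rcons u z) `&` [set w | Q (traj (size u).+1 n w)] `&` A).
Proof.
elim: n u z Q => [|n IH] u z Q.
  rewrite /=; case: (boolP (Q [::])) => Qn /=; last by rewrite mul0r mulr0 pr_ge0.
  rewrite mul1r -cyl_phi; apply: le_pr.
  - by apply: measurableI => //; exact: measurable_cyl.
  - apply: measurableI => //; apply: measurableI; first exact: measurable_cyl.
    exact: (measurable_trajb 0 0 (fun=> true)).
  - by move=> w [cw Aw].
apply: le_trans (pr_sum_next x (size u).+1 _ (nbr_uniq G z)); last first.
  apply: measurableI => //; apply: measurableI; first exact: measurable_cyl.
  exact: measurable_trajb.
rewrite /= /avg mulrCA mulr_suml big_seq [leRHS]big_seq.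
apply: ler_sum => y yz.
apply: le_trans (le_trans (IH (rcons u z) y (fun s => Q (y :: s))) _).
  by rewrite pr_cyl_step yz le_eqVlt; apply/orP; left; apply/eqP; ring.
rewrite size_rcons; apply: le_pr.
- apply: measurableI => //; apply: measurableI; first exact: measurable_cyl.
  exact: (measurable_trajb _ n (fun s => Q (y :: s))).
- apply: measurableI; last exact: (srw_measurable srw _ [set y]).
  apply: measurableI => //; apply: measurableI; first exact: measurable_cyl.
  exact: (measurable_trajb _ n.+1 Q).
move=> w [[]]; rewrite /cyl /mkset !size_rcons traj_rcons add0n => /rcons_inj[c Sy] Qw Aw.
by split=> //; split=> //; split=> //; rewrite /mkset trajS Sy.
Qed.

(** The inequality of [markov_event_ge] for [Q] and for its complement, whose sides
    have the same sum, are equalities. *)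
Lemma markov_event n u z (Q : seq V -> bool) :
  pex G n z (fun s => phi (last z s)) = phi z ->
  pr x (cyl (rcons u z) `&` [set w | Q (traj (size u).+1 n w)] `&` A) =
  pr x (cyl (rcons u z)) * pex G n z (fun s => (Q s)%:R * phi (last z s)).
Proof.
move=> phiz.
have H1 := markov_event_ge n u z Q.
have H2 := markov_event_ge n u z (fun s => ~~ Q s).
have mC := measurable_cyl (rcons u z).
have mQ Q' := measurable_trajb (size u).+1 n Q'.
have H3 : pr x (cyl (rcons u z) `&` A) =
  pr x (cyl (rcons u z) `&` [set w | Q (traj (size u).+1 n w)] `&` A) +
  pr x (cyl (rcons u z) `&` [set w | ~~ Q (traj (size u).+1 n w)] `&` A).
  have mCA : measurable (cyl (rcons u z) `&` A) by exact: measurableI.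
  rewrite (pr_split x mCA (mQ Q)) setIAC; congr (_ + pr x _).
  by apply/seteqP; split => w /= [[cw ?] ?]; do !split => //; exact/negP.
have H4 : pex G n z (fun s => (Q s)%:R * phi (last z s)) +
          pex G n z (fun s => (~~ Q s)%:R * phi (last z s)) = phi z.
  rewrite -phiz -pexD; apply: eq_pex => s _.
  by case: (Q s); rewrite /= mul0r mul1r ?addr0 ?add0r.
have H5 : pr x (cyl (rcons u z)) * phi z =
  pr x (cyl (rcons u z)) * pex G n z (fun s => (Q s)%:R * phi (last z s)) +
  pr x (cyl (rcons u z)) * pex G n z (fun s => (~~ Q s)%:R * phi (last z s)).
  by rewrite -mulrDr H4.
apply/le_anti; rewrite H1 andbT; rewrite cyl_phi H5 in H3.
move: H2 H3; move: (pr _ _) (pr _ _) => *; lra.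
Qed.

End MarkovEvent.

Lemma markov n x u z (Q : seq V -> bool) :
  pr x (cyl (rcons u z) `&` [set w | Q (traj (size u).+1 n w)]) =
  pr x (cyl (rcons u z)) * pex G n z (fun s => (Q s)%:R).
Proof.
have H u' z' : pr x (cyl (rcons u' z') `&` setT) = pr x (cyl (rcons u' z')) * 1.
  by rewrite setIT mulr1.
have := @markov_event x setT (fun=> 1) measurableT H n u z Q.
rewrite pex_cst setIT => /(_ erefl) ->; congr (_ * _).
by apply: eq_pex => s _; rewrite mulr1.
Qed.

Lemma pr_start x : pr x (cyl [:: x]) = 1.
Proof.
rewrite /pr (_ : cyl _ = [set w | S 0%N w = x]) ?(srw_start srw)//.
by apply/seteqP; split => w; rewrite /cyl /traj /=; [case|move=> ->].
Qed.

(** Under [P x] the first steps have the law described by [pex]. *)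
Lemma law n x (Q : seq V -> bool) :
  P x [set w | Q (traj 0 n.+1 w)] = (pex G n x (fun s => (Q (x :: s))%:R))%:E.
Proof.
have mQ := measurable_trajb.
rewrite prE; last exact: mQ.
congr EFin; have := markov n x [::] x (fun s => Q (x :: s)).
rewrite /= pr_start mul1r => <-.
rewrite -(prI1 (mQ 0%N n.+1 Q) (measurable_cyl [:: x]) (pr_start x)).
congr (pr x _); apply/seteqP; split => w; rewrite /cyl /traj /=.
  by move=> [Qw [S0]]; split; rewrite -?S0.
by move=> [[S0] Qw]; rewrite S0.
Qed.

Lemma heat_kernelE n x y : heat_kernel S P n x y = hk R G n x y.
Proof.
rewrite /heat_kernel /hk; have := law n x (fun s => last x s == y).
rewrite (_ : [set w | _] = [set w | S n w = y]) => [->//|].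
apply/seteqP; split => w; rewrite /mkset traj_rcons last_rcons add0n; first by move/eqP.
by move=> ->.
Qed.

Lemma no_return_probE n x : no_return_prob S P n x = (noret R G n x)%:E.
Proof.
rewrite /no_return_prob /noret.
suff <- : [set w | x \notin behead (traj 0 n.+1 w)] =
    [set w | ((n%:R : R)%:E < return_time S x w)%E].
  exact: (law n x (fun s => x \notin behead s)).
apply/seteqP; split => w /= H.
  apply: (@lt_le_trans _ _ (n.+1%:R : R)%:E); first by rewrite lte_fin ltr_nat.
  apply: le_ereal_inf_tmp => _ [k [k1 Sk] <-]; rewrite lee_fin ler_nat ltnNge.
  apply/negP => kn; move/negP: H; apply; apply/mapP; exists k => //.
  by rewrite mem_iota k1 add1n ltnS.
apply/negP => /mapP[k]; rewrite mem_iota add1n ltnS => /andP[k1 kn] xS.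
move: H; apply/negP; rewrite -leNgt; apply: (@le_trans _ _ (k%:R : R)%:E); last by rewrite lee_fin ler_nat.
by apply: ereal_inf_lbound; exists k.
Qed.

Lemma range_sizeE n w : range_size S n w = size (undup (traj 0 n.+1 w)).
Proof.
rewrite /range_size /set_size.
rewrite (_ : [set S k w | k in `I_n.+1] = [set` undup (traj 0 n.+1 w)]).
  rewrite (_ : fset_set _ = [fset y | y in undup (traj 0 n.+1 w)]%fset); last first.
    apply/fsetP => y; rewrite in_fset_set ?inE; last exact: finite_seq.
    by apply/idP/idP; rewrite !inE.
  by rewrite card_fseq undup_id// undup_uniq.
apply/seteqP; split => y; rewrite /mkset mem_undup.
  by move=> [k kn <-]; apply/mapP; exists k => //; rewrite mem_iota.
by move=> /mapP[k]; rewrite mem_iota => /andP[_ kn] ->; exists k.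
Qed.

End PathLaw.

(** * Almost sure bounds *)
Lemma sqr_le_geometric (R : realType) (a : nat) : a%:R ^+ 2 <= 8 * (3 / 2) ^+ a :> R.
Proof.
have [a5|] := leqP a 5.
  by do 6 (case: a a5 => [_|a a5]; first by rewrite !exprS expr0; lra).
elim: a => [//|a IH]; rewrite ltnS leq_eqVlt => /orP[/eqP <-|a5].
  by rewrite !exprS expr0; lra.
have a6 : 6 <= a%:R :> R by rewrite ler_nat.
have : (a.+1)%:R ^+ 2 <= 3 / 2 * a%:R ^+ 2 :> R by rewrite -natr1 !expr2; nra.
by move=> /le_trans; apply; rewrite [in leRHS]exprS [leRHS]mulrCA ler_wpM2l// IH.
Qed.

Lemma borel_cantelli (R : realType) (disp : measure_display) (T : measurableType disp)
    (mu : {measure set T -> \bar R}) (F : (set T)^nat) (Q : R) : 0 <= Q ->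
  (forall k, measurable (F k)) ->
  (forall k, (mu (F k) <= (Q * (3 / 4) ^+ k)%:E)%E) ->
  {ae mu, forall w, exists N : nat, forall k, (N <= k)%N -> ~ F k w}.
Proof.
move=> Q0 mF hF; have H : mu (lim_sup_set F) = 0%E.
  apply: lim_sup_set_cvg0 => //.
  apply: (@le_lt_trans _ _ (4 * Q)%:E); last exact: ltry.
  apply: lime_le; first by apply: is_cvg_nneseries => n _ _; exact: measure_ge0.
  apply: nearW => n; apply: (@le_trans _ _ (\sum_(0 <= k < n) (Q * (3 / 4) ^+ k)%:E)).
    by apply: lee_sum => k _; exact: hF.
  rewrite sumEFin lee_fin -mulr_sumr mulrC ler_wpM2r//.
  suff -> : \sum_(0 <= k < n) (3 / 4) ^+ k = 4 - 4 * (3 / 4) ^+ n :> R.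
    by rewrite gerBl mulr_ge0// exprn_ge0// divr_ge0.
  elim: n => [|n IH]; first by rewrite big_geq// expr0 mulr1 subrr.
  by rewrite big_nat_recr//= IH exprS; field.
have mL : measurable (lim_sup_set F).
  by apply: bigcap_measurable => // n _; apply: bigcup_measurable.
exists (lim_sup_set F); split => // w /= /forallNP nw n _.
have [k /not_implyP[nk /contrapT Fk]] : exists k, ~ ((n <= k)%N -> ~ F k w).
  by apply/existsNP; exact: nw n.
by exists k.
Qed.

Section AlmostSure.
Variables (R : realType) (V : choiceType) (e : rel V).
Variables (disp : measure_display) (Omega : measurableType disp).
Variables (S : nat -> Omega -> V) (P : V -> probability Omega R).
Hypothesis srw : simple_random_walk e S P.
Hypothesis V_count : countable [set: V].
Variable G : lfgraph V.
Hypothesis GE : forall x y, (y \in G x) = e x y.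
Hypothesis Gdeg : forall x, degree e x = size (G x).
Local Notation traj := (traj S).

Lemma take_traj m n w : (m <= n)%N -> take m (traj 0 n w) = traj 0 m w.
Proof. by move=> mn; rewrite /traj -map_take take_iota (minn_idPl mn). Qed.

(** If for every large [a] and every [k] in [2^a, 2^(a+1)) the event [B n] occurs for
    some [n] in [2^k, 2^(k+1)) with probability O(a^2 / 4^a), then almost surely
    only finitely many [B n] occur. *)
Lemma dyadic_ae x (B : nat -> seq V -> bool) (Q : R) a0 : 0 <= Q ->
  (forall a k, (a0 <= a)%N -> (2 ^ a <= k < 2 ^ a.+1)%N ->
    pex G (2 ^ k.+1) x (fun s => (has (fun n => B n (x :: take n s))
       (index_iota (2 ^ k) (2 ^ k.+1)))%:R) <= Q * (a.+1%:R ^+ 2 / 4 ^+ a)) ->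
  {ae P x, forall w, exists N, forall n, (N <= n)%N -> ~~ B n (traj 0 n.+1 w)}.
Proof.
move=> Q0 hB.
pose badr k (s : seq V) := has (fun n => B n (take n.+1 s)) (index_iota (2 ^ k) (2 ^ k.+1)).
(* a time horizon that contains all the scales [k < 2 ^ a.+1] *)
pose T a := (2 ^ (2 ^ a.+1))%N.
pose F a := [set w | has (badr^~ (traj 0 (T (a + a0)%N).+1 w)) (index_iota (2 ^ (a + a0)) (2 ^ (a + a0).+1))].
have mF a : measurable (F a).
  exact: (measurable_trajb srw V_count 0 (T (a + a0)%N).+1 (fun s => has (badr^~ s) _)).
have PF a : (P x (F a) <= (12 * Q * (3 / 4) ^+ a)%:E)%E.
  rewrite (law srw V_count GE Gdeg (T (a + a0)%N) x (fun s => has (badr^~ s) _)) lee_fin.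
  set a' := (a + a0)%N.
  apply: le_trans (@pex_has R V G (T a') x nat _ (fun k s => badr k (x :: s))) _.
  apply: (le_trans (y := \sum_(2 ^ a' <= k < 2 ^ a'.+1) Q * (a'.+1%:R ^+ 2 / 4 ^+ a'))).
    apply: ler_sum_nat => k kk; have /andP[k1 k2] := kk.
    apply: le_trans (hB a' k (leq_addl _ _) kk).
    rewrite -(@pex_prefix _ _ _ (2 ^ k.+1) (T a')); last by rewrite leq_exp2l.
    apply: le_pex => s _; rewrite ler_nat; case: (boolP (badr k _)) => //= /hasP[n nk Bn].
    suff -> : has (fun n0 => B n0 (x :: take n0 (take (2 ^ k.+1) s))) (index_iota (2 ^ k) (2 ^ k.+1)) by [].
    apply/hasP; exists n => //; rewrite take_takel//.
    by move: nk; rewrite mem_index_iota => /andP[_ /ltnW].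
  rewrite sumr_const_nat expnS mul2n -addnn addnK -[leLHS]mulr_natr natrX.
  have -> : 4 ^+ a' = 2 ^+ a' * 2 ^+ a' :> R by rewrite -exprMn_comm; [congr (_ ^+ _); lra|exact: mulrC].
  have h := sqr_le_geometric R a'.+1.
  have p : 0 < 2 ^+ a' :> R by rewrite exprn_gt0.
  rewrite [leLHS](_ : _ = Q * (a'.+1%:R ^+ 2 / 2 ^+ a')); last by field; rewrite gt_eqF.
  rewrite [leRHS](_ : _ = Q * (12 * (3 / 4) ^+ a)); last by ring.
  rewrite ler_wpM2l// ler_pdivrMr//; apply: le_trans h _.
  have -> : 8 * (3 / 2) ^+ a'.+1 = 12 * (3 / 4) ^+ a' * 2 ^+ a' :> R.
    rewrite -mulrA -exprMn_comm; last exact: mulrC.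
    have -> : 3 / 4 * 2 = 3 / 2 :> R by lra.
    by rewrite exprS; lra.
  rewrite ler_wpM2r ?(ltW p)// ler_wpM2l//.
  rewrite /a' exprD -[leRHS]mulr1 ler_wpM2l//.
  by rewrite exprn_ile1//; lra.
have : {ae P x, forall w, exists N : nat, forall a, (N <= a)%N -> ~ F a w}.
  by apply: (@borel_cantelli _ _ _ _ _ (12 * Q)) => //; rewrite mulr_ge0.
apply: filterS => w [N HN]; exists (2 ^ (2 ^ (N + a0)))%N => n Nn.
apply/negP => Bn.
have n0 : (0 < n)%N by rewrite (leq_trans _ Nn)// expn_gt0.
pose k := trunc_log 2 n; pose a := trunc_log 2 k.
have /andP[k1 k2] : (2 ^ k <= n < 2 ^ k.+1)%N by exact: trunc_log_bounds.
have Nk : (2 ^ (N + a0) <= k)%N.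
  by rewrite /k -(@trunc_expnK 2 (2 ^ (N + a0)))// leq_trunc_log.
have k0 : (0 < k)%N by rewrite (leq_trans _ Nk)// expn_gt0.
have /andP[a1 a2] : (2 ^ a <= k < 2 ^ a.+1)%N by exact: trunc_log_bounds.
have Na : (N + a0 <= a)%N.
  by rewrite /a -(@trunc_expnK 2 (N + a0))// leq_trunc_log.
have aE : (a - a0 + a0 = a)%N by rewrite subnK// (leq_trans _ Na)// leq_addl.
apply: (HN (a - a0)%N); first by rewrite leq_subRL ?(leq_trans _ Na) ?leq_addl// addnC.
rewrite /F /= aE; apply/hasP; exists k; first by rewrite mem_index_iota a1.
apply/hasP; exists n; first by rewrite mem_index_iota k1.
by rewrite take_traj// ltnS (leq_trans (ltnW k2))// /T leq_exp2l//.
Qed.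

End AlmostSure.

Section LimSupInf.
Variable R : realType.
Implicit Types (u : (\bar R)^nat) (t : \bar R).

Lemma limn_esup_le u t N : (forall n, (N <= n)%N -> (u n <= t)%E) -> (limn_esup u <= t)%E.
Proof.
move=> H; apply: ge_ereal_inf; exists (ereal_sup [set u n | n in [set n | (N <= n)%N]]).
  by exists [set n | (N <= n)%N] => //; exists N.
by apply: ge_ereal_sup => _ [n /= Nn <-]; exact: H.
Qed.

Lemma limn_esup_lt u t : (limn_esup u < t)%E ->
  exists N : nat, forall n, (N <= n)%N -> (u n < t)%E.
Proof.
move=> /ereal_inf_lt[_ [A [N _ NA] <-] At]; exists N => n Nn.
apply: le_lt_trans At; apply: ereal_sup_ubound; exists n => //; exact: NA.
Qed.

Lemma limn_einf_ge u t N : (forall n, (N <= n)%N -> (t <= u n)%E) -> (t <= limn_einf u)%E.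
Proof.
move=> H; rewrite /limn_einf leeNr; apply: (@limn_esup_le _ _ N) => n Nn /=.
by rewrite leeN2 H.
Qed.

Lemma limn_einf_gt u t : (t < limn_einf u)%E ->
  exists N : nat, forall n, (N <= n)%N -> (t < u n)%E.
Proof.
rewrite /limn_einf lteNr => /limn_esup_lt[N H]; exists N => n /H.
by rewrite lteN2.
Qed.

End LimSupInf.

(** * Harmonic functions and the zero-one law *)
Section HarmonicFunctions.
Variables (R : realType) (V : eqType) (G : lfgraph V) (phi : V -> R).
Hypothesis phi01 : forall x, 0 <= phi x <= 1.
Hypothesis phi_harm : forall x, phi x = avg G x phi.

(** Optional stopping: [phi x] is the mean of [phi] at the position of the walk
    stopped at [y] or at time [n], which is [y] with probability [hit n x y]. *)
Lemma harmonic_hit n x y : `|phi x - phi y| <= 1 - hit R G n x y.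
Proof.
elim: n x => [|n IH] x.
  rewrite hit0; case: eqP => [->|_]; first by rewrite !subrr normr0.
  have /andP[x0 x1] := phi01 x; have /andP[y0 y1] := phi01 y.
  by rewrite subr0 ler_norml; apply/andP; split; lra.
have [->|xy] := eqVneq x y; first by rewrite hitxx !subrr normr0.
rewrite hitS// (phi_harm x).
have -> : avg G x phi - phi y = avg G x (fun z => phi z - phi y).
  by rewrite -{1}(avg_cst G x (- phi y)) -avgD.
have -> : 1 - avg G x (fun z => hit R G n z y) = avg G x (fun z => 1 - hit R G n z y).
  rewrite avgD avg_cst; congr (_ + _).
  rewrite -[LHS]mulN1r -avgZ; apply: eq_avg => z _; exact: mulN1r.
rewrite ler_norml -[X in X <= _ <= _]mulN1r -avgZ; apply/andP; split.
  apply: le_avg => z _; have := IH z; rewrite ler_norml => /andP[h _].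
  by rewrite mulN1r.
by apply: le_avg => z _; have := IH z; rewrite ler_norml => /andP[_].
Qed.

Hypothesis recurrent : forall x (eps : R), 0 < eps -> exists n, noret R G n.+1 x <= eps.

(** The walk from [y] that steps to [x] without coming back to [y] does not
    return, so [1 - hit n x y] is at most [deg y * noret n.+1 y]. *)
Lemma harmonic_adjacent x y : x \in G y -> phi x = phi y.
Proof.
move=> xy; apply/eqP; rewrite -subr_eq0 -normr_le0; apply/ler_addgt0Pr => eps eps0.
rewrite add0r; have dy : 0 < (size (G y))%:R :> R by rewrite ltr0n nbr_gt0.
have [n hn] := recurrent y (divr_gt0 eps0 dy).
apply: le_trans (harmonic_hit n x y) _.
move: hn; rewrite ler_pdivlMr//; apply: le_trans.
rewrite noretS.
have -> : 1 - avg G y (fun z => hit R G n z y) = avg G y (fun z => 1 - hit R G n z y).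
  rewrite avgD avg_cst; congr (_ + _).
  rewrite -[LHS]mulN1r -avgZ; apply: eq_avg => z _; exact: mulN1r.
rewrite /avg mulfVK ?gt_eqF//.
rewrite (bigD1_seq x)//=; last exact: nbr_uniq.
by rewrite lerDl sumr_ge0// => z _; rewrite subr_ge0 hit_le1.
Qed.

End HarmonicFunctions.

Section ZeroOne.
Variables (R : realType) (V : choiceType) (e : rel V).
Variables (disp : measure_display) (Omega : measurableType disp).
Variables (S : nat -> Omega -> V) (P : V -> probability Omega R).
Hypothesis srw : simple_random_walk e S P.
Hypothesis V_count : countable [set: V].
Variable G : lfgraph V.
Hypothesis GE : forall x y, (y \in G x) = e x y.
Hypothesis Gdeg : forall x, degree e x = size (G x).
Hypothesis e_conn : connected_graph e.
Hypothesis recurrent : forall x (eps : R), 0 < eps -> exists n, noret R G n.+1 x <= eps.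
Local Notation traj := (traj S).
Local Notation pr := (pr P).
Local Notation cyl := (cyl S).

(** The events on path space that depend on finitely many coordinates; [n.+1]
    makes the starting point one of them. *)
Definition path_events : set (set (nat -> V)) :=
  [set A | exists n (Q : set (seq V)), A = [set s | Q (mkseq s n.+1)]].

Lemma path_events_setI : setI_closed path_events.
Proof.
move=> A B [n [Q ->]] [m [Q' ->]]; exists (n + m)%N.
exists [set u | Q (take n.+1 u) /\ Q' (take m.+1 u)].
have E k (s : nat -> V) : (k <= n + m)%N -> take k.+1 (mkseq s (n + m).+1) = mkseq s k.+1.
  by move=> k_le; rewrite /mkseq -map_take take_iota (minn_idPl _).
by apply/seteqP; split => s; rewrite /mkset !E ?leq_addr ?leq_addl.
Qed.

(** The trajectory from time [k] on, as a point of path space. *)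
Definition shifted (k : nat) (w : Omega) : nat -> V := fun j => S (k + j)%N w.

Lemma mkseq_shifted k n w : mkseq (shifted k w) n = traj k n w.
Proof. by rewrite /traj -[in RHS](addn0 k) iotaDl -map_comp; exact: eq_map. Qed.

(* Markov property at a fixed time for events of the future *)
(** The events of path space for which the Markov property holds at every fixed
    time.  They form a Dynkin class ([markov_class_dynkin]) containing
    [path_events], hence contain the generated sigma-algebra. *)
Definition markov_class : set (set (nat -> V)) := [set A |
  (forall k, measurable [set w | A (shifted k w)]) /\
  (forall x u z, (P x (cyl (rcons u z) `&` [set w | A (shifted (size u) w)]) =
     P x (cyl (rcons u z)) * P z [set w | A (shifted 0 w)])%E)].

Lemma markov_class_dynkin : dynkin markov_class.
Proof.
split.
- split => [k|x u z]; first by rewrite (_ : [set w | _] = setT)//; apply/seteqP; split.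
  rewrite (_ : [set w | [set: nat -> V] (shifted (size u) w)] = setT); last by apply/seteqP; split.
  by rewrite setIT probability_setT mule1.
- move=> A [mA hA]; split => [k|x u z]; first exact: measurableC (mA k).
  have mC := measurable_cyl srw V_count (rcons u z).
  have mc k : measurable (~` [set w | A (shifted k w)]) by exact: measurableC.
  rewrite -[[set w | _ (shifted (size u) w)]]/(~` [set w | A (shifted (size u) w)]).
  rewrite -[[set w | _ (shifted 0 w)]]/(~` [set w | A (shifted 0 w)]).
  rewrite probability_setC//.
  have := hA x u z; rewrite !(prE P) //; last 2 first.
  + exact: measurableI.
  + exact: measurableI.
  rewrite -EFinM => -[h].
  rewrite -[X in _ = (_ * X)%E]/((1 - pr z [set w | A (shifted 0 w)])%:E) -EFinM; congr EFin.
  have := pr_split P x mC (mA (size u)); rewrite setDE h => h2.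
  by rewrite mulrBr mulr1 [X in _ = X - _]h2; ring.
- move=> F tF hF; have mF k n : measurable [set w | F n (shifted k w)] by have [+ _] := hF n; exact.
  have E k : [set w | (\bigcup_n F n) (shifted k w)] = \bigcup_n [set w | F n (shifted k w)].
    by apply/seteqP; split => w [n _ Fn]; exists n.
  split => [k|x u z]; first by rewrite E; exact: bigcup_measurable.
  have mC := measurable_cyl srw V_count (rcons u z).
  rewrite !E setI_bigcupr.
  have tk k : trivIset [set: nat] (fun n => [set w | F n (shifted k w)]).
    by move=> i j _ _ [w [Fi Fj]]; apply: tF => //; exists (shifted k w).
  rewrite measure_semi_bigcup//=; last 3 first.
  + by move=> n; exact: measurableI.
  + by move=> i j _ _ [w [[_ Fi] [_ Fj]]]; apply: tF => //; exists (shifted (size u) w).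
  + by apply: bigcup_measurable => n _; exact: measurableI.
  rewrite measure_semi_bigcup//=; last exact: bigcup_measurable.
  rewrite prE// -nneseriesZl//.
  by apply: eq_eseriesr => n _; have [_ ->] := hF n; rewrite prE.
Qed.

Lemma path_events_markov : path_events `<=` markov_class.
Proof.
move=> _ [n [Q ->]]; split => [k|x u z].
  rewrite (_ : [set w | _] = [set w | Q (traj k n.+1 w)]); first exact: (measurable_traj srw V_count).
  by apply/seteqP; split => w; rewrite /mkset mkseq_shifted.
have mC := measurable_cyl srw V_count (rcons u z).
rewrite (_ : [set w | _ (shifted 0 w)] = [set w | `[< Q (traj 0 n.+1 w) >]]); last first.
  by apply/seteqP; split => w; rewrite /mkset mkseq_shifted => /asboolP.
rewrite (law srw V_count GE Gdeg n z (fun s => `[< Q s >])).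
rewrite (_ : cyl (rcons u z) `&` _ =
   cyl (rcons u z) `&` [set w | `[< Q (z :: traj (size u).+1 n w) >]]).
  have mQ := measurable_trajb srw V_count (size u).+1 n (fun s => `[< Q (z :: s) >]).
  rewrite (prE P _ (measurableI _ _ mC mQ)) (prE P _ mC).
  by rewrite (markov srw V_count GE Gdeg n x u z (fun s => `[< Q (z :: s) >])) EFinM.
apply/seteqP; split => w; rewrite /mkset => -[cw].
  rewrite mkseq_shifted trajS => Qw; split => //; apply/asboolP; move: cw Qw.
  by rewrite /cyl /mkset size_rcons traj_rcons add0n => /rcons_inj[_ ->].
move=> /asboolP Qw; split => //; rewrite mkseq_shifted trajS; move: cw Qw.
by rewrite /cyl /mkset size_rcons traj_rcons add0n => /rcons_inj[_ ->].
Qed.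

Lemma future_markov A : <<s path_events >> A -> markov_class A.
Proof.
apply: (lambda_system_subset path_events_setI (D := setT)) => //.
  exact/dynkin_lambda_system/markov_class_dynkin.
exact: path_events_markov.
Qed.

Variable A : set (nat -> V).
Hypothesis mA : <<s path_events >> A.
Hypothesis invA : forall s, A (fun j => s j.+1) <-> A s.

Lemma shifted_inv k : [set w | A (shifted k w)] = [set w | A (shifted 0 w)].
Proof.
elim: k => // k <-; apply/seteqP; split => w; rewrite /mkset.
  have -> : shifted k.+1 w = (fun j => shifted k w j.+1).
    by apply/funext => j; rewrite /shifted addSnnS.
  by move/invA.
have -> : shifted k.+1 w = (fun j => shifted k w j.+1).
  by apply/funext => j; rewrite /shifted addSnnS.
exact: (invA (shifted k w)).2.
Qed.

Let EA : set Omega := [set w | A (shifted 0 w)].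
Let phi z := pr z EA.

Lemma measurable_inv_event : measurable EA.
Proof. by have [H _] := future_markov mA; exact: H. Qed.

Lemma cyl_inv_event x u z : pr x (cyl (rcons u z) `&` EA) = pr x (cyl (rcons u z)) * phi z.
Proof.
have [_ H] := future_markov mA; have := H x u z; rewrite shifted_inv -/EA.
have mC := measurable_cyl srw V_count (rcons u z).
have mE := measurable_inv_event.
by rewrite !(prE P)//; [rewrite -EFinM => -[]|exact: measurableI].
Qed.

Lemma inv_prob01 x : 0 <= phi x <= 1.
Proof.
rewrite /phi pr_ge0/= -(prT P x); apply: le_pr => //; exact: measurable_inv_event.
Qed.

Lemma inv_prob_harmonic x : phi x = avg G x phi.
Proof.
have mE := measurable_inv_event; have mEc := measurableC mE.
(* [EA] and its complement both give superharmonic functions *)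
have cyl_EAc u z : pr x (cyl (rcons u z) `&` ~` EA) = pr x (cyl (rcons u z)) * (1 - phi z).
  have mC := measurable_cyl srw V_count (rcons u z).
  have := pr_split P x mC mE; rewrite cyl_inv_event setDE => h.
  by rewrite mulrBr mulr1 [X in X - _]h; ring.
have le1 (B : set Omega) (psi : V -> R) : measurable B ->
    (forall u z, pr x (cyl (rcons u z) `&` B) = pr x (cyl (rcons u z)) * psi z) ->
    avg G x psi <= psi x.
  move=> mB hB.
  have := markov_event_ge srw V_count GE Gdeg mB hB 1 [::] x xpredT.
  rewrite /= (pr_start srw) mul1r => h.
  have -> : psi x = pr x (cyl [:: x] `&` [set w | true] `&` B).
    have := hB [::] x; rewrite /= (pr_start srw) mul1r => <-.
    congr pr; apply/seteqP; split => w /=; first by move=> [cw Bw].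
    by move=> [[cw _] Bw].
  apply: le_trans h; rewrite le_eqVlt; apply/orP; left; apply/eqP.
  by apply: eq_avg => y _; rewrite mul1r.
apply/le_anti; rewrite (le1 _ _ mE (cyl_inv_event x)) andbT.
have := le1 _ _ mEc cyl_EAc; rewrite avgD avg_cst.
have -> : avg G x (fun y => - phi y) = - avg G x phi.
  rewrite -mulN1r -avgZ; apply: eq_avg => z _; by rewrite mulN1r.
by lra.
Qed.

Lemma inv_prob_cst x y : phi x = phi y.
Proof.
have H p z : path e z p -> phi z = phi (last z p).
  elim: p z => [//|t p IH] z /= /andP[zt /IH <-].
  apply: (@harmonic_adjacent R V G phi inv_prob01 inv_prob_harmonic recurrent).
  by rewrite nbr_sym GE.
by have [n [p [pp <- _]]] := e_conn x y; exact: H.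
Qed.

(** The event is independent of every event in [path_events], hence, by the
    pi-lambda theorem, of itself. *)
Lemma zero_one : exists b : bool, forall x, pr x EA = b%:R.
Proof.
case: (pselect (exists x : V, True)) => [[x0 _]|nV]; last first.
  by exists true => x; exfalso; apply: nV; exists x.
suff : phi x0 = 0 \/ phi x0 = 1.
  case=> H; [exists false|exists true] => x; by rewrite -/(phi x) (inv_prob_cst x x0) H.
have mE := measurable_inv_event.
(* the events independent of [EA]; they will be shown to include [EA] itself *)
pose H := [set B : set (nat -> V) | measurable [set w | B (shifted 0 w)] /\
  (P x0 ([set w | B (shifted 0 w)] `&` EA) = P x0 [set w | B (shifted 0 w)] * (phi x0)%:E)%E].
suff HA : <<s path_events >> `<=` H.
  have [_] := HA A mA; rewrite -/EA setIid (prE P)// -EFinM => -[/eqP].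
  rewrite -/(phi x0) -subr_eq0 -{1}[phi x0]mulr1 -mulrBr mulf_eq0 subr_eq0.
  by case/orP => /eqP <-; [left|right].
apply: (lambda_system_subset path_events_setI (D := setT)) => //.
  apply/dynkin_lambda_system; split.
  - rewrite /H /=; rewrite (_ : [set w | [set: nat -> V] (shifted 0 w)] = setT); last by apply/seteqP; split.
    by split => //; rewrite setTI probability_setT mul1e prE.
  - move=> B [mB hB]; split; first exact: measurableC mB.
    rewrite -[[set w | _ (shifted 0 w)]]/(~` [set w | B (shifted 0 w)]).
    rewrite probability_setC// setIC -setDE.
    move: hB; rewrite setIC !(prE P)//; last 2 first.
    + exact: measurableD.
    + exact: measurableI.
    rewrite -EFinB -!EFinM => -[h]; congr EFin.
    have := pr_split P x0 mE mB; rewrite h -/(phi x0) => h2.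
    by rewrite mulrBl mul1r [X in _ = X - _]h2; ring.
  - move=> F tF hF; have mF n : measurable [set w | F n (shifted 0 w)] by have [] := hF n.
    have E : [set w | (\bigcup_n F n) (shifted 0 w)] = \bigcup_n [set w | F n (shifted 0 w)].
      by apply/seteqP; split => w [n _ Fn]; exists n.
    split; first by rewrite E; exact: bigcup_measurable.
    rewrite !E setI_bigcupl.
    have tk : trivIset [set: nat] (fun n => [set w | F n (shifted 0 w)]).
      by move=> i j _ _ [w [Fi Fj]]; apply: tF => //; exists (shifted 0 w).
    rewrite measure_semi_bigcup//=; last 3 first.
    + by move=> n; exact: measurableI.
    + by move=> i j _ _ [w [[Fi _] [Fj _]]]; apply: tF => //; exists (shifted 0 w).
    + by apply: bigcup_measurable => n _; exact: measurableI.
    rewrite measure_semi_bigcup//=; last exact: bigcup_measurable.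
    rewrite muleC -nneseriesZl//.
    by apply: eq_eseriesr => n _; have [_ ->] := hF n; rewrite muleC.
move=> _ [n [Q ->]]; split.
  rewrite (_ : [set w | _] = [set w | Q (traj 0 n.+1 w)]); first exact: (measurable_traj srw V_count).
  by apply/seteqP; split => w; rewrite /mkset mkseq_shifted.
rewrite (_ : [set w | _ (shifted 0 w)] = [set w | `[< Q (traj 0 n.+1 w) >]]); last first.
  by apply/seteqP; split => w; rewrite /mkset mkseq_shifted => /asboolP.
have mQ := measurable_trajb srw V_count 0 n.+1 (fun s => `[< Q s >]).
rewrite (law srw V_count GE Gdeg n x0 (fun s => `[< Q s >])).
rewrite (prE P); last exact: measurableI.
rewrite -EFinM; congr EFin.
have harm : pex G n x0 (fun s => phi (last x0 s)) = phi x0.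
  rewrite -[RHS](pex_cst G n x0); apply: eq_pex => s _; exact: inv_prob_cst.
have := markov_event srw V_count GE Gdeg mE (cyl_inv_event x0) [::] (fun s => `[< Q (x0 :: s) >]) harm.
rewrite /= (pr_start srw) mul1r.
have -> : pex G n x0 (fun s => `[< Q (x0 :: s) >]%:R * phi (last x0 s)) =
    phi x0 * pex G n x0 (fun s => `[< Q (x0 :: s) >]%:R).
  rewrite -pexZ; apply: eq_pex => s _; by rewrite mulrC (inv_prob_cst (last x0 s) x0).
rewrite mulrC => <-.
have mC := measurable_cyl srw V_count [:: x0].
rewrite -(prI1 (measurableI _ _ mQ mE) mC (pr_start srw x0)).
congr pr; apply/seteqP; split => w; rewrite /cyl /traj /=.
  by move=> [[Qw Aw] [S0]]; do !split => //; rewrite -?S0.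
by move=> [[[S0] Qw] Aw]; rewrite S0.
Qed.

End ZeroOne.

(** * The limits are constant *)
Section LimSupMeasurable.
Variable R : realType.

Lemma le_limn_esup_near (u v : nat -> R) :
  (forall eps, 0 < eps -> exists N, forall n, (N <= n)%N -> u n <= v n + eps) ->
  (limn_esup (fun n => (u n)%:E) <= limn_esup (fun n => (v n)%:E))%E.
Proof.
move=> H.
have H1 (t : R) eps : 0 < eps -> (limn_esup (fun n => (v n)%:E) < t%:E)%E ->
    (limn_esup (fun n => (u n)%:E) <= (t + eps)%:E)%E.
  move=> eps0 /limn_esup_lt[N1 h1]; have [N2 h2] := H eps eps0.
  apply: (@limn_esup_le _ _ _ (N1 + N2)) => n Nn.
  have /h1 : (N1 <= n)%N by rewrite (leq_trans _ Nn)// leq_addr.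
  have := h2 n; rewrite (leq_trans _ Nn) ?leq_addl// => /(_ isT).
  rewrite !lte_fin lee_fin; lra.
case E : (limn_esup (fun n => (v n)%:E)) => [r| |]; last 2 first.
- exact: leey.
- rewrite leeNy_eq; apply/eqP; apply: eq_ninfty => M.
  by rewrite -(subrK 1 M); apply: H1 => //; rewrite E ltNyr.
apply/lee_addgt0Pr => eps eps0.
rewrite -EFinD (_ : r + eps = r + eps / 2 + eps / 2); last by lra.
by apply: H1; rewrite ?E ?lte_fin; lra.
Qed.

Lemma g_sigma_bigcap T (G : set (set T)) (A : (set T)^nat) :
  (forall n, <<s G >> (A n)) -> <<s G >> (\bigcap_n A n).
Proof.
move=> hA; have [_ SC SU] := smallest_sigma_algebra setT G.
have -> : \bigcap_n A n = setT `\` \bigcup_n (setT `\` A n).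
  by rewrite setTD setC_bigcup; apply: eq_bigcapr => n _; rewrite setTD setCK.
by apply: (SC); apply: (SU) => n; apply: (SC); exact: hA.
Qed.

Lemma g_sigma_limn_esup T (G : set (set T)) (u : nat -> T -> R) :
  (forall n t, <<s G >> [set s | u n s <= t]) ->
  forall t : R, <<s G >> [set s | (limn_esup (fun n => (u n s)%:E) <= t%:E)%E].
Proof.
move=> mu t; have [_ SC SU] := smallest_sigma_algebra setT G.
have -> : [set s | (limn_esup (fun n => (u n s)%:E) <= t%:E)%E] =
  \bigcap_m \bigcup_N \bigcap_n [set s | (N <= n)%N -> u n s <= t + m.+1%:R^-1].
  apply/seteqP; split => s /=.
    move=> H m _; have /limn_esup_lt[N hN] : (limn_esup (fun n => (u n s)%:E) < (t + m.+1%:R^-1)%:E)%E.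
      by apply: le_lt_trans H _; rewrite lte_fin ltrDl invr_gt0 ltr0n.
    by exists N => // n _ Nn; have := hN n Nn; rewrite lte_fin => /ltW.
  move=> H; apply/lee_addgt0Pr => eps eps0.
  have [m hm] : exists m : nat, m.+1%:R^-1 <= eps.
    exists (Num.truncn eps^-1); rewrite -[leRHS]invrK lef_pV2 ?posrE ?invr_gt0 ?ltr0n//.
    by rewrite ltW// truncnS_gt.
  have [N _ hN] := H m I; apply: (@limn_esup_le _ _ _ N) => n Nn.
  by rewrite -EFinD lee_fin (le_trans (hN n I Nn))// lerD2l.
apply: g_sigma_bigcap => m; apply: (SU) => N; apply: g_sigma_bigcap => n.
case: (leqP N n) => Nn.
  rewrite (_ : [set s | _] = [set s | u n s <= t + m.+1%:R^-1]); first exact: mu.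
  by apply/seteqP; split => s /=; [exact|].
rewrite (_ : [set s | _] = setT); last by apply/seteqP; split => s.
by have [S0 _ _] := smallest_sigma_algebra setT G; have := SC _ S0; rewrite setD0.
Qed.

Lemma ln_div_le (eps : R) : 0 < eps -> exists N, forall n, (N <= n)%N ->
  (n%:R / ln n%:R)^-1 <= eps.
Proof.
move=> eps0; exists (Num.truncn ((2 / eps) ^+ 2)).+1 => n Nn.
have n0 : 0 < n%:R :> R by rewrite ltr0n (leq_trans _ Nn).
have h : (2 / eps) ^+ 2 <= n%:R.
  by apply: (le_trans (ltW (truncnS_gt _))); rewrite ler_nat.
have s0 : 0 < Num.sqrt n%:R :> R by rewrite sqrtr_gt0.
have s2 : Num.sqrt n%:R ^+ 2 = n%:R :> R by rewrite sqr_sqrtr// ltW.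
have h2 : 2 / eps <= Num.sqrt n%:R.
  by rewrite -(@ler_pXn2r _ 2) ?nnegrE ?divr_ge0 ?(ltW eps0) ?(ltW s0)// s2.
rewrite invf_div ler_pdivrMr// -{1}s2 lnXn// -[leLHS]mulr_natr.
apply: (le_trans (y := Num.sqrt n%:R * 2)).
  by rewrite ler_wpM2r// ltW// ln_sublinear.
apply: (le_trans (y := Num.sqrt n%:R * (eps * Num.sqrt n%:R))).
  by rewrite ler_wpM2l ?(ltW s0)// mulrC -ler_pdivrMr.
by rewrite mulrCA -expr2 s2.
Qed.

Lemma size_undup_rcons (V : eqType) (s : seq V) y :
  (size (undup s) <= size (undup (rcons s y)) <= (size (undup s)).+1)%N.
Proof.
rewrite undup_rcons size_rcons ltnS size_filter.
have -> : size (undup s) = (count (fun z => z != y) (undup s) + count_mem y (undup s))%N.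
  by rewrite addnC -(count_predC (pred1 y)); congr (_ + _)%N; apply: eq_count.
have : (count_mem y (undup s) <= 1)%N by rewrite count_uniq_mem ?undup_uniq// leq_b1.
by move: (count _ _) (count_mem _ _) => a b; lia.
Qed.

Lemma size_undup_shift (V : eqType) (s : nat -> V) n :
  (size (undup (mkseq (fun j => s j.+1) n)) <= (size (undup (mkseq s n))).+1)%N /\
  (size (undup (mkseq s n)) <= (size (undup (mkseq (fun j => s j.+1) n))).+1)%N.
Proof.
have E : mkseq s n.+1 = s 0%N :: mkseq (fun j => s j.+1) n.
  by rewrite /mkseq /=; congr (_ :: _); rewrite -[1%N]addn0 iotaDl -map_comp.
have E' : mkseq s n.+1 = rcons (mkseq s n) (s n).
  by rewrite /mkseq -addn1 iotaD map_cat cats1.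
have /andP[h1 h2] := size_undup_rcons (mkseq s n) (s n).
rewrite -E' E /= in h1 h2.
by move: h1 h2; case: (_ \in _) => /=; lia.
Qed.

End LimSupMeasurable.

Section Constants.
Variables (R : realType) (V : choiceType) (e : rel V).
Variables (disp : measure_display) (Omega : measurableType disp).
Variables (S : nat -> Omega -> V) (P : V -> probability Omega R).
Hypothesis srw : simple_random_walk e S P.
Hypothesis V_count : countable [set: V].
Variable G : lfgraph V.
Hypothesis GE : forall x y, (y \in G x) = e x y.
Hypothesis Gdeg : forall x, degree e x = size (G x).
Hypothesis e_conn : connected_graph e.
Hypothesis recurrent : forall x (eps : R), 0 < eps -> exists n, noret R G n.+1 x <= eps.
Local Notation traj := (traj S).
Local Notation pr := (pr P).

(** For a measurable event, holding almost surely is having probability 1. *)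
Lemma pr_ae x (A : set Omega) : measurable A -> {ae P x, forall w, A w} <-> pr x A = 1.
Proof.
move=> mA; have h := pr_split P x measurableT mA; rewrite prT setTI setTD in h.
have mC := measurableC mA.
split=> [H|H].
  have : P x (~` A) = 0%E by apply: measure_negligible.
  by rewrite (prE P)// => -[h0]; rewrite h h0 addr0.
exists (~` A); split => //.
rewrite (prE P)//; congr EFin; move: h; rewrite H; lra.
Qed.

(** The constant is the infimum of the [t] such that [X] is almost surely at most
    [t]; by the zero-one law [X] exceeds every smaller value almost surely. *)
Lemma ae_constant (X : (nat -> V) -> \bar R) (M1 M2 : R) (x0 : V) :
  (forall t : R, <<s @path_events V >> [set s | (X s <= t%:E)%E]) ->
  (forall s, X (fun j => s j.+1) = X s) ->
  (forall x, {ae P x, forall w, (M1%:E <= X (shifted S 0 w) <= M2%:E)%E}) ->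
  exists c : R, forall x, {ae P x, forall w, X (shifted S 0 w) = c%:E}.
Proof.
move=> mX invX bX.
pose A t := [set w | (X (shifted S 0 w) <= t%:E)%E].
have zo t : exists b : bool, forall x, pr x (A t) = b%:R.
  apply: (zero_one srw V_count GE Gdeg e_conn recurrent (mX t)) => s.
  by rewrite /= invX.
have mA t : measurable (A t).
  by have [H _] := future_markov srw V_count GE Gdeg (mX t); exact: H.
pose T := [set t : R | pr x0 (A t) = 1].
have fullT t x : T t -> pr x (A t) = 1.
  by rewrite /T /=; have [b hb] := zo t; rewrite !hb.
have nullT t x : ~ T t -> pr x (A t) = 0.
  by rewrite /T /=; have [[] hb] := zo t; rewrite !hb.
have TM2 : T M2.
  by apply/pr_ae => //; apply: filterS (bX x0) => w /andP[].
have Tlb t : T t -> M1 <= t.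
  move=> Tt; rewrite leNgt; apply/negP => tM.
  have /(pr_ae _ (mA t)) H := Tt.
  have /(pr_ae _ _) : {ae P x0, forall w, set0 w}.
    apply: filterS2 H (bX x0) => w /= h1 /andP[h2 _].
    by have := le_trans h2 h1; rewrite lee_fin leNgt tM.
  by move=> /(_ measurable0) /eqP; rewrite pr0 eq_sym oner_eq0.
have hT : has_inf T by split; [exists M2|exists M1 => t; exact: Tlb].
pose c := inf T.
have up n : T (c + n.+1%:R^-1).
  have n0 : 0 < n.+1%:R^-1 :> R by rewrite invr_gt0.
  have [t Tt tc] := inf_adherent n0 hT.
  apply/le_anti/andP; split.
    by apply: (le_trans (y := pr x0 setT)); [exact: le_pr|rewrite prT].
  apply: (le_trans (y := pr x0 (A t))); first by rewrite (fullT t x0 Tt).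
  by apply: le_pr => // w /= h; apply: le_trans h _; rewrite lee_fin ltW.
have down n : ~ T (c - n.+1%:R^-1).
  move=> Tn; have := ge_inf hT.2 Tn; rewrite -/c.
  by apply/negP; rewrite -ltNge ltrBlDr ltrDl invr_gt0.
exists c => x.
have H1 : {ae P x, forall w, forall n, (X (shifted S 0 w) <= (c + n.+1%:R^-1)%:E)%E}.
  by apply: ae_foralln => n; apply/(pr_ae x (mA (c + n.+1%:R^-1))); apply: fullT.
have H2 : {ae P x, forall w, forall n, ((c - n.+1%:R^-1)%:E < X (shifted S 0 w))%E}.
  apply: ae_foralln => n.
  have /(pr_ae x _) H : pr x (~` A (c - n.+1%:R^-1)) = 1.
    have h := pr_split P x measurableT (mA (c - n.+1%:R^-1)).
    by rewrite prT setTI setTD nullT// add0r in h.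
  apply: filterS (H (measurableC (mA _))) => w /= /negP; by rewrite -ltNge.
apply: filterS2 H1 H2 => w h1 h2.
have small eps : 0 < eps -> exists m : nat, m.+1%:R^-1 <= eps :> R.
  move=> eps0; exists (Num.truncn eps^-1).
  by rewrite -[leRHS]invrK lef_pV2 ?posrE ?invr_gt0 ?ltr0n// ltW// truncnS_gt.
apply/le_anti/andP; split.
  apply/lee_addgt0Pr => eps /small[m hm]; apply: le_trans (h1 m) _.
  by rewrite -EFinD lee_fin lerD2l.
apply/lee_addgt0Pr => eps /small[m hm].
rewrite -leeBlDr// -EFinB; apply: le_trans _ (ltW (h2 m)).
by rewrite lee_fin lerD2l lerN2.
Qed.

(** The sign [sg] covers both limits: for [sg = - 1] the upper limit is the opposite
    of the lower limit of the scaled range. *)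
Lemma ae_constant_esup (sg : R) (M1 M2 : R) (x0 : V) :
  let g n (s : seq V) := sg * ((size (undup s))%:R / (n%:R / ln n%:R)) in
  (forall x, {ae P x, forall w, (M1%:E <= limn_esup (fun n => (g n (traj 0 n.+1 w))%:E) <= M2%:E)%E}) ->
  exists c : R, forall x, {ae P x, forall w, limn_esup (fun n => (g n (traj 0 n.+1 w))%:E) = c%:E}.
Proof.
move=> g H.
have gE n w : g n (traj 0 n.+1 w) = g n (mkseq (shifted S 0 w) n.+1) by rewrite mkseq_shifted.
have limE w : limn_esup (fun n => (g n (traj 0 n.+1 w))%:E) =
   limn_esup (fun n => (g n (mkseq (shifted S 0 w) n.+1))%:E).
  by congr limn_esup; apply/funext => n; rewrite gE.
have [|||c hc] := @ae_constant (fun s => limn_esup (fun n => (g n (mkseq s n.+1))%:E)) M1 M2 x0; last first.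
- by exists c => x; apply: filterS (hc x) => w; rewrite limE.
- by move=> x; apply: filterS (H x) => w; rewrite limE.
- have diff (s : nat -> V) eps : 0 < eps -> exists N, forall n, (N <= n)%N ->
     `|g n (mkseq (fun j => s j.+1) n.+1) - g n (mkseq s n.+1)| <= eps.
    move=> eps0; have sg0 : 0 < `|sg| + 1 by rewrite ltr_wpDl.
    have [N hN] := ln_div_le (divr_gt0 eps0 sg0); exists N.+1 => n Nn.
    have := hN n (ltnW Nn); rewrite /g -mulrBr -mulrBl 2!normrM.
    have i0 : 0 <= (n%:R / ln n%:R)^-1 :> R.
      by rewrite invr_ge0 divr_ge0// ln_ge0// ler1n (leq_trans _ Nn).
    rewrite (ger0_norm i0) ler_pdivlMr// => h.
    have [h1 h2] := size_undup_shift s n.+1.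
    have d1 : `|(size (undup (mkseq (fun j => s j.+1) n.+1)))%:R - (size (undup (mkseq s n.+1)))%:R| <= 1 :> R.
      rewrite ler_norml; apply/andP; split.
        by rewrite lerBrDr addrC lerBlDr natr1 ler_nat.
      by rewrite lerBlDr addrC natr1 ler_nat.
    apply: le_trans h; rewrite mulrA [leLHS]mulrC ler_wpM2l//.
    apply: (le_trans (y := `|sg| * 1)); first by rewrite ler_wpM2l.
    by rewrite mulr1 lerDl.
  move=> s; apply/le_anti/andP; split; apply: le_limn_esup_near => eps eps0;
    have [N hN] := diff s eps eps0; exists N => n /hN; rewrite ler_norml => /andP[]; lra.
- move=> t; apply: (g_sigma_limn_esup (u := fun n s => g n (mkseq s n.+1))) => n t'.
  by apply: sub_sigma_algebra; exists n, [set l | g n l <= t'].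
Qed.

End Constants.

(** * Comparison with the escape probabilities *)
Section EscapeProbability.
Variables (R : realType) (V : eqType) (G : lfgraph V) (c : R).
Hypothesis c_gt0 : 0 < c.
Hypothesis hk_lower : forall n x, (0 < n)%N -> c / n%:R <= hk R G n x x + hk R G n.+1 x x.

Lemma noret_ln_le n x : (2 <= n)%N -> noret R G n x * ln n%:R <= 8 / c.
Proof.
move=> n2; pose k := trunc_log 2 n.
have n0 : (0 < n)%N by rewrite (leq_trans _ n2).
have /andP[k1 k2] : (2 ^ k <= n < 2 ^ k.+1)%N by exact: trunc_log_bounds.
have k0 : (0 < k)%N by rewrite /k trunc_log_gt0.
have nR : 0 < n%:R :> R by rewrite ltr0n.
have h1 : ln n%:R <= 2 * k%:R :> R.
  apply: (le_trans (y := ln (2 ^ k.+1)%:R)).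
    by rewrite ler_ln ?posrE ?ltr0n ?expn_gt0// ler_nat ltnW.
  rewrite ln_exp2; apply: (le_trans (y := k.+1%:R * 1)).
    by rewrite ler_wpM2l// ln2_le1.
  by rewrite mulr1 -natrM ler_nat mul2n -addnn -addn1 leq_add2l.
have h2 := noret_log (ltW c_gt0) hk_lower k x.
have h3 : noret R G n x <= noret R G (2 ^ k) x by exact: le_noret.
rewrite ler_pdivlMr//.
apply: (le_trans (y := noret R G (2 ^ k) x * (2 * k%:R) * c)).
  rewrite ler_wpM2r ?(ltW c_gt0)// ler_pM ?noret_ge0// ln_ge0// ler1n//.
by move: (noret R G (2 ^ k) x) h2 => q h2; lra.
Qed.

Lemma noret_small x (eps : R) : 0 < eps -> exists n, noret R G n.+1 x <= eps.
Proof.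
move=> eps0; pose K := (Num.truncn (4 / (c * eps))).+1; exists (2 ^ K).-1.
rewrite prednK ?expn_gt0//.
have h : 4 / (c * eps) <= K%:R by rewrite ltW// truncnS_gt.
have h2 := noret_log (ltW c_gt0) hk_lower K x.
have ce : 0 < c * eps by rewrite mulr_gt0.
have h3 : eps^-1 <= c / 4 * K%:R.
  rewrite [leLHS](_ : _ = c / 4 * (4 / (c * eps))); last by field; rewrite !gt_eqF.
  by rewrite ler_wpM2l// divr_ge0// ltW.
have h4 : noret R G (2 ^ K) x * eps^-1 <= 1.
  by apply: le_trans h2; rewrite ler_wpM2l ?noret_ge0.
by rewrite -[eps]mul1r -ler_pdivrMr.
Qed.

End EscapeProbability.

Lemma le_of_ae (R : realType) (disp : measure_display) (T : measurableType disp)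
   (mu : probability T R) (Q : Prop) : {ae mu, forall w : T, Q} -> Q.
Proof.
move=> H; apply: contrapT => nQ.
have : mu setT = 0%E.
  apply: measure_negligible => //; apply: negligibleS H => w _ /=; exact: nQ.
by rewrite probability_setT => /eqP; rewrite eqe oner_eq0.
Qed.

(** The process is now compared with the graph [G] and the constants of the
    on-diagonal bounds. *)
Section LimitBounds.
Variables (R : realType) (V : choiceType) (e : rel V).
Variables (disp : measure_display) (Omega : measurableType disp).
Variables (S : nat -> Omega -> V) (P : V -> probability Omega R).
Hypothesis srw : simple_random_walk e S P.
Hypothesis V_count : countable [set: V].
Variable G : lfgraph V.
Hypothesis GE : forall x y, (y \in G x) = e x y.
Hypothesis Gdeg : forall x, degree e x = size (G x).
Variables (D : nat) (C c : R).
Hypothesis deg_le : forall x, (size (G x) <= D)%N.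
Hypothesis C_ge0 : 0 <= C.
Hypothesis c_gt0 : 0 < c.
Hypothesis hk_upper : forall n x y, (0 < n)%N -> hk R G n x y <= C / n%:R.
Hypothesis hk_lower : forall n x, (0 < n)%N -> c / n%:R <= hk R G n x x + hk R G n.+1 x x.
Local Notation traj := (traj S).

Lemma scaled_rangeE n w :
  scaled_range S n w = (size (undup (traj 0 n.+1 w)))%:R / (n%:R / ln n%:R) :> R.
Proof. by rewrite /scaled_range range_sizeE. Qed.

(** Also for [n = 0] and [n = 1], where the inverse of 0 is 0. *)
Lemma scale_ge0 n : 0 <= (n%:R / ln n%:R)^-1 :> R.
Proof.
case: n => [|n]; first by rewrite mul0r invr0.
by rewrite invr_ge0 divr_ge0// ln_ge0// ler1n.
Qed.

Lemma scaled_range_ge0 n w : 0 <= scaled_range S n w :> R.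
Proof. by rewrite mulr_ge0// scale_ge0. Qed.

Lemma limsup_le_ae (r t : R) n0 x : 0 < r -> r < t ->
  (forall n x, (n0 <= n)%N -> noret R G n x * ln n%:R <= r) ->
  {ae P x, forall w, (limn_esup (fun n => (scaled_range S n w)%:E) <= t%:E)%E}.
Proof.
move=> r0 rt hr; have [Q Q0 [a0 hQ]] := upper_dev r0 rt hr.
have := @dyadic_ae R V e disp Omega S P srw V_count G GE Gdeg x
  (fun n u => t * n%:R < (size (undup u))%:R * ln n%:R) Q a0 Q0 (fun a k => hQ a k x).
apply: filterS => w [N hN]; apply: (@limn_esup_le _ _ _ N.+1) => n Nn.
have n_gt0 : 0 < n%:R :> R by rewrite ltr0n (leq_trans _ Nn).
rewrite lee_fin scaled_rangeE invf_div mulrA ler_pdivrMr// leNgt.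
exact: hN (ltnW Nn).
Qed.

Lemma liminf_ge_ae (r t : R) n0 x : 0 < t -> t < r ->
  (forall n x, (n0 <= n)%N -> r <= noret R G n x * ln n%:R) ->
  {ae P x, forall w, (t%:E <= limn_einf (fun n => (scaled_range S n w)%:E))%E}.
Proof.
move=> t0 tr hr.
have [Q Q0 [a0 hQ]] := lower_dev deg_le C_ge0 c_gt0 hk_upper hk_lower t0 tr hr.
have := @dyadic_ae R V e disp Omega S P srw V_count G GE Gdeg x
  (fun n u => (size (undup u))%:R * ln n%:R < t * n%:R) Q a0 Q0 (fun a k => hQ a k x).
apply: filterS => w [N hN]; apply: (@limn_einf_ge _ _ _ N.+1) => n Nn.
have n_gt0 : 0 < n%:R :> R by rewrite ltr0n (leq_trans _ Nn).
rewrite lee_fin scaled_rangeE invf_div mulrA ler_pdivlMr// leNgt.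
exact: hN (ltnW Nn).
Qed.

Lemma no_return_bound (t : R) (x : V) : (r_sup S P < t%:E)%E ->
  0 < t /\ exists n0, forall n x, (n0 <= n)%N -> noret R G n x * ln n%:R <= t.
Proof.
move=> /limn_esup_lt[N hN].
have H n y : (N.+1 <= n)%N -> noret R G n y * ln n%:R < t.
  move=> Nn; rewrite -lte_fin; apply: le_lt_trans (hN n (ltnW Nn)).
  rewrite mulrC EFinM -(no_return_probE srw V_count GE Gdeg); apply: lee_wpmul2l.
    by rewrite lee_fin ln_ge0// ler1n (leq_trans _ Nn).
  by apply: ereal_sup_ubound; exists y.
split; last by exists N.+1 => n y Nn; rewrite ltW// H.
by apply: le_lt_trans (H N.+1 x (leqnn _)); rewrite mulr_ge0 ?noret_ge0// ln_ge0// ler1n.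
Qed.

Lemma no_return_lower (t : R) : (t%:E < r_inf S P)%E ->
  exists n0, forall n x, (n0 <= n)%N -> t <= noret R G n x * ln n%:R.
Proof.
move=> /limn_einf_gt[N hN]; exists N.+1 => n y Nn.
rewrite -lee_fin; apply: le_trans (ltW (hN n (ltnW Nn))) _.
rewrite mulrC EFinM -(no_return_probE srw V_count GE Gdeg); apply: lee_wpmul2l.
  by rewrite lee_fin ln_ge0// ler1n (leq_trans _ Nn).
by apply: ereal_inf_lbound; exists y.
Qed.

Lemma measurable_scaled_range n : measurable_fun setT ((fun w => (scaled_range S n w)%:E) : Omega -> \bar R).
Proof.
move=> _ B mB; rewrite setTI.
rewrite (_ : _ @^-1` _ = [set w | B ((size (undup (traj 0 n.+1 w)))%:R / (n%:R / ln n%:R))%:E]).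
  exact: (measurable_traj srw V_count 0 n.+1 (fun u => B ((size (undup u))%:R / (n%:R / ln n%:R))%:E)).
by apply/seteqP; split => w; rewrite /preimage /mkset scaled_rangeE.
Qed.

Lemma measurable_range_size n : measurable_fun setT ((fun w => (range_size S n w)%:R%:E) : Omega -> \bar R).
Proof.
move=> _ B mB; rewrite setTI.
rewrite (_ : _ @^-1` _ = [set w | B ((size (undup (traj 0 n.+1 w)))%:R)%:E]).
  exact: (measurable_traj srw V_count 0 n.+1 (fun u => B ((size (undup u))%:R)%:E)).
by apply/seteqP; split => w; rewrite /preimage /mkset range_sizeE.
Qed.

Lemma integral_scaled_range x n :
  (\int[P x]_w (scaled_range S n w)%:E = scaled_mean_range S P x n)%E.
Proof.
rewrite /scaled_mean_range unlock muleC -ge0_integralZl_EFin//.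
- by apply: eq_integral => w _; rewrite -EFinM mulrC.
- exact: measurable_range_size.
- exact: scale_ge0.
Qed.

Lemma fatou_range x (a : R) :
  {ae P x, forall w, limn_einf (fun n => (scaled_range S n w)%:E) = a%:E} ->
  (a%:E <= limn_einf (scaled_mean_range S P x))%E.
Proof.
move=> Ha.
have h0 n w : setT w -> (0 <= (scaled_range S n w : R)%:E)%E.
  by move=> _; rewrite lee_fin scaled_range_ge0.
have := fatou (P x) measurableT measurable_scaled_range h0.
rewrite (_ : (fun n => _) = scaled_mean_range S P x); last first.
  by apply/funext => n; exact: integral_scaled_range.
apply: le_trans.
rewrite (@ae_eq_integral _ _ _ _ _ (cst a%:E))//.
- by rewrite integral_cst// -[leLHS]mule1 -(probability_setT (P x)); exact: lexx.
- rewrite (_ : (fun w => _) = (fun w => - limn_esup (fun n => - (scaled_range S n w)%:E))%E)//.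
  apply: measurableT_comp => //.
  apply: measurable_fun_limn_esup => n; apply: measurableT_comp => //.
  exact: measurable_scaled_range.
- by apply: filterS Ha => w ->.
Qed.

End LimitBounds.
Lemma ereal_lt_real_between (R : realType) (c : R) (r : \bar R) :
  (c%:E < r)%E -> exists2 t : R, c < t & (t%:E < r)%E.
Proof.
case: r => [r| |] // cr; last by exists (c + 1); rewrite ?ltry// ltrDl.
rewrite lte_fin in cr; exists ((c + r) / 2); rewrite ?lte_fin; lra.
Qed.

Theorem theorem1p5 (R : realType) (V : choiceType) (e : rel V)
  (e_sym : symmetric e) (e_irr : irreflexive e)
  (V_inf : infinite_set [set: V]) (e_conn : connected_graph e)
  (e_deg : bounded_degrees e)
  (disp : measure_display) (Omega : measurableType disp)
  (S : nat -> Omega -> V) (P : V -> probability Omega R)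
  (srw : simple_random_walk e S P)
  (d : R) (d_gt1 : 1 < d)
  (regular : ahlfors_regular e d)
  (upper : sub_gaussian_upper e S P d)
  (lower : sub_gaussian_lower e S P d) :
  exists c_inf c_sup : R,
    [/\ forall x : V, {ae P x, forall w : Omega,
          limn_einf (fun n => (scaled_range S n w)%:E) = c_inf%:E},
        forall x : V, {ae P x, forall w : Omega,
          limn_esup (fun n => (scaled_range S n w)%:E) = c_sup%:E},
        forall x : V, (r_inf S P <= c_inf%:E)%E /\
          (c_inf%:E <= limn_einf (scaled_mean_range S P x))%E &
        [/\ (r_inf S P <= c_inf%:E)%E, c_inf <= c_sup &
          (c_sup%:E <= r_sup S P)%E]].
Proof.
have [x0 _] : exists x0 : V, True.
  by apply: contrapT => H; apply: V_inf; rewrite (_ : setT = set0)//;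
    apply/seteqP; split => // x _; apply: H; exists x.
have V_count := vertices_countable regular x0.
have [G [GE Gdeg] [D deg_le]] := walk_graph e_conn e_sym V_inf e_deg.
have [C C_ge0 hC] := heat_kernel_le d_gt1 regular upper.
have [c c_gt0 hc] := heat_kernel_diag_ge d_gt1 regular lower.
have hkE := heat_kernelE srw V_count GE Gdeg.
have hk_upper n x y : (0 < n)%N -> hk R G n x y <= C / n%:R.
  by move=> n0; rewrite -hkE; exact: hC.
have hk_lower n x : (0 < n)%N -> c / n%:R <= hk R G n x x + hk R G n.+1 x x.
  by move=> n0; rewrite -!hkE; exact: hc.
have recurrent := noret_small c_gt0 hk_lower.
pose K := 8 / c.
have K_gt0 : 0 < K by rewrite divr_gt0.
have limsup_K x : {ae P x, forall w, (limn_esup (fun n => (scaled_range S n w)%:E) <= (K + 1)%:E)%E}.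
  apply: (@limsup_le_ae _ _ _ _ _ _ _ srw V_count G GE Gdeg K (K + 1) 2 x K_gt0) => [|n y n2].
    by rewrite ltrDl.
  exact: (noret_ln_le c_gt0 hk_lower y n2).
have liminf_0 w : (0 <= limn_einf (fun n => (scaled_range S n w : R)%:E))%E.
  by apply: (@limn_einf_ge _ _ _ 0) => n _; rewrite lee_fin scaled_range_ge0.
have inf_sup w := limn_einf_sup (fun n => (scaled_range S n w : R)%:E).
have [c_sup hsup] : exists c_sup : R, forall x, {ae P x, forall w,
    limn_esup (fun n => (scaled_range S n w)%:E) = c_sup%:E}.
  have E w : limn_esup (fun n => (scaled_range S n w)%:E) = limn_esup (fun n =>
      (1 * ((size (undup (traj S 0 n.+1 w)))%:R / (n%:R / ln n%:R)))%:E) :> \bar R.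
    by congr limn_esup; apply/funext => n; rewrite mul1r scaled_rangeE.
  have [|c0 hc0] := @ae_constant_esup R V e disp Omega S P srw V_count G GE Gdeg e_conn
    recurrent 1 0 (K + 1) x0.
    move=> x; apply: filterS (limsup_K x) => w; rewrite -E => ->.
    by rewrite andbT (le_trans (liminf_0 w)).
  by exists c0 => x; apply: filterS (hc0 x) => w; rewrite -E.
have [c_inf hinf] : exists c_inf : R, forall x, {ae P x, forall w,
    limn_einf (fun n => (scaled_range S n w)%:E) = c_inf%:E}.
  have E w : limn_einf (fun n => (scaled_range S n w)%:E) = (- limn_esup (fun n =>
      (- 1 * ((size (undup (traj S 0 n.+1 w)))%:R / (n%:R / ln n%:R)))%:E))%E :> \bar R.
    rewrite /limn_einf; congr (- limn_esup _)%E.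
    by apply/funext => n; rewrite mulN1r scaled_rangeE.
  have [|c0 hc0] := @ae_constant_esup R V e disp Omega S P srw V_count G GE Gdeg e_conn
    recurrent (- 1) (- (K + 1)) 0 x0.
    move=> x; apply: filterS (limsup_K x) => w h.
    have h1 := le_trans (inf_sup w) h; have h2 := liminf_0 w.
    rewrite E in h1 h2; apply/andP; split.
      by rewrite EFinN leeNl.
    by rewrite -leeN2 oppe0.
  by exists (- c0) => x; apply: filterS (hc0 x) => w; rewrite E => ->.
have inf_le_sup : c_inf <= c_sup.
  apply: (@le_of_ae _ _ _ (P x0)); apply: filterS2 (hinf x0) (hsup x0) => w h1 h2.
  by have := inf_sup w; rewrite h1 h2 lee_fin.
have c_inf_ge0 : 0 <= c_inf.
  apply: (@le_of_ae _ _ _ (P x0)); apply: filterS (hinf x0) => w h1.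
  by have := liminf_0 w; rewrite h1 lee_fin.
have r_inf_le : (r_inf S P <= c_inf%:E)%E.
  rewrite leNgt; apply/negP => /ereal_lt_real_between[t ct tr].
  have [n0 hn0] := no_return_lower srw V_count GE Gdeg tr.
  have t'0 : 0 < (c_inf + t) / 2 by lra.
  have t't : (c_inf + t) / 2 < t by lra.
  have H := liminf_ge_ae srw V_count GE Gdeg deg_le C_ge0 c_gt0 hk_upper hk_lower x0 t'0 t't hn0.
  have : (c_inf + t) / 2 <= c_inf.
    apply: (@le_of_ae _ _ _ (P x0)); apply: filterS2 (hinf x0) H => w -> .
    by rewrite lee_fin.
  by lra.
have r_sup_ge : (c_sup%:E <= r_sup S P)%E.
  rewrite leNgt; apply/negP; rewrite -lteN2 -EFinN => /ereal_lt_real_between[t ct].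
  rewrite -[t in t%:E]opprK EFinN lteN2 => tr.
  have [t0 [n0 hn0]] := no_return_bound srw V_count GE Gdeg x0 tr.
  have t't : - t < (c_sup - t) / 2 by lra.
  have H := limsup_le_ae srw V_count GE Gdeg x0 t0 t't hn0.
  have : c_sup <= (c_sup - t) / 2.
    apply: (@le_of_ae _ _ _ (P x0)); apply: filterS2 (hsup x0) H => w -> .
    by rewrite lee_fin.
  by lra.
exists c_inf, c_sup; split => // x; split => //.
exact: (fatou_range srw V_count (hinf x)).
Qed.
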